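(* Let $d\geq 1$ be an integer and let $G=(V,E)$ be a finite graph with maximum degree $d$. Then $G$ is realizable as a unit distance graph in $\mathbb{R}^d$, except if $d=3$ and $G$ contains the complete bipartite graph $K_{3,3}$ as a subgraph.
   Context: All graphs are finite, simple and undirected. A graph $G=(V,E)$ is realizable in a subset $X\subseteq\mathbb{R}^d$ (as a unit distance graph) if there is an injective map $\phi\colon V\to X$ such that $|\phi(x)-\phi(y)|=1$ for every edge $xy\in E$, where $|\cdot|$ is the Euclidean norm. Non-adjacent vertices are also allowed to be mapped to points at distance $1$, but distinct vertices must be mapped to distinct points. *)

(* Defs.v *)
From mathcomp Require Import all_boot all_order all_algebra.
From mathcomp Require Import all_classical all_reals.

Set Implicit Arguments.
Unset Strict Implicit.
Unset Printing Implicit Defensive.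

Import GRing.Theory.

Local Open Scope ring_scope.

Record sgraph := SGraph {
  vertex :> finType;
  adj : rel vertex;
  adj_sym : symmetric adj;
  adj_irrefl : irreflexive adj }.

Definition degree (G : sgraph) (x : G) : nat := #|[set y | adj x y]|%SET.

(* The maximum over the empty vertex set is 0. *)
Definition max_degree (G : sgraph) : nat := (\max_(x : G) degree x)%N.

(* [H] is isomorphic to a subgraph, not necessarily induced, of [G]. *)
Definition contains_subgraph (G H : sgraph) : Prop :=
  exists f : H -> G, injective f /\ forall x y : H, adj x y -> adj (f x) (f y).

Definition bip_adj (m n : nat) : rel ('I_m + 'I_n)%type :=
  fun x y => match x, y with
             | inl _, inr _ | inr _, inl _ => true
             | _, _ => false
             end.

Lemma bip_adj_sym (m n : nat) : symmetric (@bip_adj m n).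
Proof. by case=> ? []. Qed.

Lemma bip_adj_irrefl (m n : nat) : irreflexive (@bip_adj m n).
Proof. by case. Qed.

Definition complete_bipartite (m n : nat) : sgraph :=
  SGraph (@bip_adj_sym m n) (@bip_adj_irrefl m n).

(* The library's norm on ['rV[R]_d] is the sup norm. *)
Definition euclidean_norm (R : realType) (d : nat) (u : 'rV[R]_d) : R :=
  Num.sqrt (\sum_(i < d) u 0 i ^+ 2).

Definition realizable (R : realType) (d : nat) (X : set 'rV[R]_d)
    (G : sgraph) : Prop :=
  exists phi : G -> 'rV[R]_d,
    [/\ injective phi,
        forall x : G, X (phi x)
      & forall x y : G, adj x y -> euclidean_norm (phi x - phi y) = 1].

(* Main.v *)
(** Let every vertex outside an independent set [I] be put on a unit sphere of
one of several mutually orthogonal planes, together with one 3-space if [d] is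
odd.  Vertices of different blocks are then at distance [sqrt 2], so inside a
block adjacent vertices only have to be orthogonal, and a vertex of [I] whose
neighbours form a basis is put at one of the two points at distance [sqrt 2]
from all of them.  (Everything is finally divided by [sqrt 2].)

As in Lovász's partition theorem, a partition minimizing a weighted number of
edges inside the parts has induced maximum degree at most 1 in the planes and 2
in the 3-space.  The weights are perturbed so that [I] is as small as possible,
which forces a vertex of [I] to have exactly 2 neighbours in each plane and 3
in the 3-space.  Exchange arguments show that at most two vertices of [I] have
the same neighbourhood, unless [d = 3] and there is a [K_{3,3}].

In the planes a matching is placed with no two points on a line through the
origin.  In the 3-space paths and cycles are placed one vertex at a time, each
generic on the great circle orthogonal to its placed neighbour; cycles come
first, and the last vertex of a cycle is a cross product. *)

Require Import Defs.
From mathcomp Require Import all_boot all_order all_algebra.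
From mathcomp Require Import all_classical all_reals.
From mathcomp Require Import zify ring lra.

Set Implicit Arguments.
Unset Strict Implicit.
Unset Printing Implicit Defensive.

(** * Cost-minimal partitions into an independent part and blocks *)

Section Partition.
Variables (G : sgraph) (J : finType) (n : J -> nat).

Definition part_degree (g : {ffun G -> option J}) (x : G) (c : option J) : nat :=
  (\sum_(y : G) (adj x y && (g y == c)))%N.

(* [3 * (2 - m)] where [m] is the maximum degree allowed in the
   part, plus a perturbation: 2 for the independent part and 1 for the 3-space. *)
Definition part_weight (c : option J) : nat :=
  if c is Some j then (if n j == 2 then 3 else 1) else 8.

(** Each edge inside a part is counted twice by the first sum, so the factor 2 on the weights keeps
    the ratio of 3 per edge to [part_weight] per vertex. *)
Definition cost (g : {ffun G -> option J}) : nat :=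
  (3 * (\sum_x part_degree g x (g x)) + 2 * \sum_x part_weight (g x))%N.

Definition move (g : {ffun G -> option J}) (v : G) (c : option J) :=
  [ffun x => if x == v then c else g x].

(** Only the summand [y = v] changes; the additive form avoids truncated subtraction. *)
Lemma part_degree_move g v c x i :
  (part_degree (move g v c) x i + (adj x v && (g v == i)) =
   part_degree g x i + (adj x v && (c == i)))%N.
Proof.
rewrite /part_degree (bigD1 v) //= [in RHS](bigD1 v) //= !ffunE eqxx.
rewrite (@eq_bigr _ _ _ _ _ (fun y => y != v)
   (fun y => nat_of_bool (adj x y && (move g v c y == i)))
   (fun y => nat_of_bool (adj x y && (g y == i)))) => [|y yv]; last first.
  by rewrite ffunE (negbTE yv).
by rewrite addnAC [RHS]addnAC; congr addn; rewrite addnC.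
Qed.

(** Only the weight of [v] and the edges at [v] change, and these edges are counted from both ends,
    whence the factor 2. *)
Lemma cost_move g v c :
  (cost (move g v c) + 2 * (3 * part_degree g v (g v) + part_weight (g v)) =
   cost g + 2 * (3 * part_degree g v c + part_weight c))%N.
Proof.
have inner (h : {ffun G -> option J}) : (forall x, x != v -> h x = g x) ->
    (\sum_x part_degree h x (h x) = 2 * part_degree h v (h v) +
     \sum_(x | x != v) \sum_(y | y != v) (adj x y && (g y == g x)))%N.
  move=> hg; rewrite (bigD1 v) //= mul2n -addnn -addnA; congr addn.
  have -> : part_degree h v (h v) = (\sum_(x | x != v) (adj x v && (h v == h x)))%N.
    rewrite /part_degree (bigD1 v) //= adj_irrefl add0n.
    by apply: eq_bigr => y _; rewrite adj_sym eq_sym.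
  rewrite -big_split /=; apply: eq_bigr => x xv.
  rewrite /part_degree (bigD1 v) //=; congr addn.
  by apply: eq_bigr => y yv; rewrite !hg.
have self : part_degree (move g v c) v c = part_degree g v c.
  by have := part_degree_move g v c v c; rewrite adj_irrefl; lia.
rewrite /cost (inner g) // (inner (move g v c)) => [|x xv]; last first.
  by rewrite ffunE (negbTE xv).
have splitw (h : {ffun G -> option J}) : (\sum_x part_weight (h x) =
    part_weight (h v) + \sum_(x | x != v) part_weight (h x))%N by rewrite (bigD1 v).
rewrite (splitw g) (splitw (move g v c)).
rewrite (@eq_bigr _ _ _ _ _ (fun y => y != v)
   (fun y => part_weight (move g v c y)) (fun y => part_weight (g y))) => [|y yv]; last first.
  by rewrite ffunE (negbTE yv).
rewrite !ffunE eqxx self.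
set s := (\sum_(x | x != v) \sum_(y | _) _)%N; set t := (\sum_(x | x != v) _)%N; lia.
Qed.

Definition optimal (g : {ffun G -> option J}) := forall h, (cost g <= cost h)%N.

Lemma optimal_exists : exists g, optimal g.
Proof.
exists [arg min_(g < [ffun=> None]) cost g].
by case: arg_minnP => // g _ gmin h; exact: gmin.
Qed.

Lemma optimal_move g v c : optimal g ->
  (3 * part_degree g v (g v) + part_weight (g v) <=
   3 * part_degree g v c + part_weight c)%N.
Proof. by move=> /(_ (move g v c)); have := cost_move g v c; lia. Qed.

Lemma sum_part_degree g x :
  (part_degree g x None + \sum_j part_degree g x (Some j) = degree x)%N.
Proof.
rewrite /part_degree exchange_big -big_split /degree cardsE -sum1_card [RHS]big_mkcond /=.
apply: eq_bigr => y _; rewrite -[y \in _]/(adj x y).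
case: (adj x y) => /=; last by rewrite big1.
case: (g y) => [j|] /=; last by rewrite big1.
rewrite (bigD1 j) //= eqxx big1 // => i /negbTE.
by rewrite eq_sym => ij; apply/eqP; rewrite eqb0; apply/eqP => -[ji]; rewrite ji eqxx in ij.
Qed.

Lemma part_degreeE g x c :
  part_degree g x c = #|[set y | adj x y & g y == c]%SET|.
Proof.
rewrite -sum1_card /part_degree [RHS]big_mkcond.
by apply: eq_bigr => y _; rewrite inE; case: (_ && _).
Qed.

Lemma part_degree_gt0 (g : {ffun G -> option J}) x y c :
  adj x y -> g y = c -> (0 < part_degree g x c)%N.
Proof.
by move=> xy gy; rewrite part_degreeE card_gt0; apply/set0Pn; exists y; rewrite inE xy gy /=.
Qed.

Lemma part_degree_eq0 (g : {ffun G -> option J}) x y c :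
  part_degree g x c = 0%N -> g y = c -> adj x y = false.
Proof.
by move=> d0 gy; apply/negP => xy; have := part_degree_gt0 xy gy; rewrite d0.
Qed.

Lemma part_degree_ge_size (g : {ffun G -> option J}) x c (s : seq G) : uniq s ->
  (forall y, y \in s -> adj x y /\ g y = c) -> (size s <= part_degree g x c)%N.
Proof.
move=> us sx; rewrite part_degreeE -(card_uniqP us); apply/subset_leq_card/fintype.subsetP => y ys.
by rewrite inE; have [-> ->] := sx _ ys; rewrite eqxx.
Qed.

Variable d : nat.
Hypothesis n23 : forall j, n j = 2%N \/ n j = 3%N.
Hypothesis n3_unique : forall i j, n i = 3%N -> n j = 3%N -> i = j.
Hypothesis sum_n : (\sum_j n j = d)%N.
Hypothesis degree_le : forall x : G, (degree x <= d)%N.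

(** Pigeonhole: otherwise the neighbours in part [None] and in the blocks other than [j0] would
    already exceed [d]. This finds a destination for a vertex leaving the plane [j0]. *)
Lemma light_part g x j0 : (n j0 < part_degree g x None)%N ->
  exists2 j, j != j0 & (part_degree g x (Some j) < n j)%N.
Proof.
move=> big0; case: (pickP [pred j | (j != j0) && (part_degree g x (Some j) < n j)%N]).
  by move=> j /andP[]; exists j.
move=> heavy; have := degree_le x; rewrite -(sum_part_degree g) -sum_n.
rewrite (bigD1 j0) //= [in X in (_ <= X)%N](bigD1 j0) //=.
have : (\sum_(j | j != j0) n j <= \sum_(j | j != j0) part_degree g x (Some j))%N.
  by apply: leq_sum => j jj0; have := heavy j; rewrite /= jj0 /= ltnNge => /negbFE.
lia.
Qed.

Variable g : {ffun G -> option J}.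
Hypothesis g_opt : optimal g.

(** With a neighbour in [None], optimality would force at least [n j] neighbours in every block [j],
    which makes more than [d] in total. *)
Lemma optimal_none_edgeless x : g x = None -> part_degree g x None = 0%N.
Proof.
move=> gx; apply/eqP; rewrite -leqn0 leqNgt; apply/negP => pos.
have := degree_le x; rewrite -(sum_part_degree g) -sum_n.
have : (\sum_j n j <= \sum_j part_degree g x (Some j))%N.
  apply: leq_sum => j _; have := optimal_move x (Some j) g_opt; rewrite gx /=.
  by case: (n23 j) => -> /=; lia.
lia.
Qed.

(** Otherwise no move is profitable only if [x] has at least [n i] neighbours in every block [i] and
    one more in [None], again exceeding [d]. *)
Lemma optimal_some_degree x j : g x = Some j -> (part_degree g x (Some j) < n j)%N.
Proof.
move=> gx; rewrite ltnNge; apply/negP => pos.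
have := degree_le x; rewrite -(sum_part_degree g) -sum_n.
have : (\sum_j n j <= \sum_j part_degree g x (Some j))%N.
  apply: leq_sum => i _; have := optimal_move x (Some i) g_opt; rewrite gx /=.
  by case: (n23 i) => -> /=; case: (n23 j) pos => -> /=; lia.
have := optimal_move x None g_opt; rewrite gx /=.
by case: (n23 j) pos => -> /=; lia.
Qed.

(** The perturbed weight 8, instead of 6, forces at least [n i] neighbours in every block [i]; the
    degree bound turns these into equalities. *)
Lemma optimal_none_degree x j : g x = None -> part_degree g x (Some j) = n j.
Proof.
move=> gx; have le_n i : (n i <= part_degree g x (Some i))%N.
  have := optimal_move x (Some i) g_opt; rewrite gx /=.
  by case: (n23 i) => -> /=; lia.
have := degree_le x; rewrite -(sum_part_degree g) -sum_n.
rewrite (bigD1 j) //= [in X in (_ <= X)%N](bigD1 j) //=.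
have : (\sum_(i | i != j) n i <= \sum_(i | i != j) part_degree g x (Some i))%N.
  by apply: leq_sum => i _; apply: le_n.
by have := le_n j; lia.
Qed.

(** The perturbed weight 1, instead of 0, forces two neighbours in every plane; with the two in the
    3-space, the degree bound leaves room for a single one in [None]. *)
Lemma optimal_none_neighbors x j : n j = 3%N -> g x = Some j ->
  part_degree g x (Some j) = 2%N -> (part_degree g x None <= 1)%N.
Proof.
move=> nj gx dx; have le_n i : i != j -> (n i <= part_degree g x (Some i))%N.
  move=> ij; have := optimal_move x (Some i) g_opt; rewrite gx /= dx nj /=.
  case: (n23 i) => ni; rewrite ni /=; first lia.
  by rewrite (n3_unique ni nj) eqxx in ij.
have := degree_le x; rewrite -(sum_part_degree g) -sum_n.
rewrite (bigD1 j) //= [in X in (_ <= X)%N](bigD1 j) //= dx nj.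
have : (\sum_(i | i != j) n i <= \sum_(i | i != j) part_degree g x (Some i))%N.
  by apply: leq_sum => i; apply: le_n.
lia.
Qed.

(* Exchanging [x] and [u] does not change the cost, so in the new optimal
   partition [y] still has at most two neighbours in its part. *)
Lemma optimal_swap u x y j : n j = 3%N -> g u = None -> g x = Some j -> g y = Some j ->
  adj u x -> adj u y -> y != x -> part_degree g x (Some j) = 2%N ->
  part_degree g y (Some j) = 2%N -> adj x y.
Proof.
move=> nj gu gx gy ux uy yx dx dy; apply: contraT => xy.
have uNx : u != x by apply: contra_eq_neq gx => <-; rewrite gu.
have uNy : u != y by apply: contra_eq_neq gy => <-; rewrite gu.
set h1 := move g x None; set h := move h1 u (Some j).
have h1u : h1 u = None by rewrite ffunE (negbTE uNx).
have du := optimal_none_edgeless gu; have duj := optimal_none_degree j gu.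
have dx1 := optimal_none_neighbors nj gx dx.
have du1 : part_degree h1 u None = 1%N.
  by have := part_degree_move g x None u None; rewrite ux gx /= -/h1 du; lia.
have duj1 : part_degree h1 u (Some j) = 2%N.
  by have := part_degree_move g x None u (Some j); rewrite ux gx eqxx /= -/h1 duj nj; lia.
(* By [dx1], moving [x] out raises the cost by at most 2 * (11 - 7) = 8, and moving [u] in lowers it
   by the same amount. *)
have h_opt : optimal h.
  move=> k; apply: leq_trans (g_opt k).
  have := cost_move g x None; have := cost_move h1 u (Some j).
  by rewrite -/h -/h1 gx h1u du1 duj1 dx /= nj /=; lia.
have hy : h y = Some j by rewrite !ffunE eq_sym (negbTE uNy) (negbTE yx).
(* The counting of [optimal_some_degree], repeated for the partition [h]. *)
have cap : (part_degree h y (Some j) < 3)%N.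
  rewrite ltnNge; apply/negP => pos.
  have := degree_le y; rewrite -(sum_part_degree h) -sum_n.
  have : (\sum_j n j <= \sum_j part_degree h y (Some j))%N.
    apply: leq_sum => i _; have := optimal_move y (Some i) h_opt; rewrite hy /= nj /=.
    by case: (n23 i) => -> /=; lia.
  by have := optimal_move y None h_opt; rewrite hy /= nj /=; lia.
(* Not being adjacent to [x], the vertex [y] keeps its two neighbours and gains [u] as a third,
   against [cap]. *)
have := part_degree_move h1 u (Some j) y (Some j); have := part_degree_move g x None y (Some j).
rewrite -/h -/h1 h1u (adj_sym y u) uy eqxx (adj_sym y x) (negbTE xy) /= dy.
lia.
Qed.

(* Two common neighbours of the twins can leave a plane, and two twins enter it,
   at a total gain. *)
Lemma optimal_twins v1 v2 v3 : (0 < d)%N -> uniq [:: v1; v2; v3] ->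
  g v1 = None -> g v2 = None -> g v3 = None ->
  (forall y, adj v1 y = adj v2 y) -> (forall y, adj v1 y = adj v3 y) ->
  d = 3%N /\ contains_subgraph G (complete_bipartite 3 3).
Proof.
move=> d_gt0 uv g1 g2 g3 tw2 tw3.
have gv v : v \in [:: v1; v2; v3] -> g v = None by rewrite !inE => /or3P[] /eqP->.
have tw v y : v \in [:: v1; v2; v3] -> adj v y = adj v1 y.
  by rewrite !inE => /or3P[] /eqP->.
case: (pickP (fun j => n j == 2%N)) => [j0 /eqP n2|no2].
  exfalso; have dj0 v : v \in [:: v1; v2; v3] -> part_degree g v (Some j0) = 2%N.
    by move=> /gv /optimal_none_degree ->.
  have /eqP := dj0 v1 (mem_head _ _); rewrite part_degreeE => /cards2P[a [b [ab Nab]]].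
  have in_set_adj y : (y \in [set y | adj v1 y & g y == Some j0]%SET) =
      adj v1 y && (g y == Some j0) by rewrite inE.
  have /andP[v1a /eqP ga] : adj v1 a && (g a == Some j0).
    by rewrite -in_set_adj Nab !inE eqxx.
  have /andP[v1b /eqP gb] : adj v1 b && (g b == Some j0).
    by rewrite -in_set_adj Nab !inE eqxx orbT.
  have [j jj0 light_a] : exists2 j, j != j0 & (part_degree g a (Some j) < n j)%N.
    apply: light_part; rewrite n2; apply: (part_degree_ge_size (s := [:: v1; v2; v3])) => // v vs.
    by rewrite gv // adj_sym tw.
  set h1 := move g a (Some j).
  have h1v v : v \in [:: v1; v2; v3] -> h1 v = None.
    by move=> vs; rewrite ffunE; case: eqP => [va|_]; [rewrite -va gv in ga|apply: gv].
  have h1b : h1 b = Some j0 by rewrite ffunE eq_sym (negbTE ab).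
  have [i ij0 light_b] : exists2 i, i != j0 & (part_degree h1 b (Some i) < n i)%N.
    apply: light_part; rewrite n2; apply: (part_degree_ge_size (s := [:: v1; v2; v3])) => // v vs.
    by rewrite h1v // adj_sym tw.
  set h2 := move h1 b (Some i).
  have h2v v : v \in [:: v1; v2; v3] -> h2 v = None.
    by move=> vs; rewrite ffunE; case: eqP => [vb|_]; [rewrite -vb gv in gb|apply: h1v].
  have dv v : v \in [:: v1; v2; v3] -> part_degree h2 v (Some j0) = 0%N.
    move=> vs; have := part_degree_move h1 b (Some i) v (Some j0).
    have := part_degree_move g a (Some j) v (Some j0).
    rewrite -/h1 -/h2 ga h1b dj0 // !(tw v) // v1a v1b eqxx /=.
    rewrite !(inj_eq Some_inj) (negbTE jj0) (negbTE ij0); lia.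
  set h3 := move h2 v1 (Some j0).
  have v12 : v2 != v1 by move: uv; rewrite /= !inE negb_or eq_sym => /andP[/andP[]].
  have h3v2 : h3 v2 = None by rewrite ffunE (negbTE v12) h2v // !inE eqxx orbT.
  have d3 : part_degree h3 v2 (Some j0) = 0%N.
    have := part_degree_move h2 v1 (Some j0) v2 (Some j0).
    rewrite -/h3 dv ?(inE, eqxx, orbT) // -tw2 adj_irrefl /=; lia.
  (* Each of [a] and [b] goes from a charge of at least 3 to one of at most 7, each of [v1] and [v2]
     from at least 8 to 3. After doubling, at most 16 is lost and at least 20 is gained. *)
  have := cost_move g a (Some j); have := cost_move h1 b (Some i).
  have := cost_move h2 v1 (Some j0); have := cost_move h3 v2 (Some j0).
  rewrite -/h1 -/h2 -/h3 ga h1b h2v ?(inE, eqxx) // h3v2 d3 dv ?(inE, eqxx) //= n2 /=.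
  have := g_opt (move h3 v2 (Some j0)).
  by case: (n23 j) (n23 i) light_a light_b => -> [] -> /=; lia.
(* Without planes the 3-space is the only block, so [d = 3], and the twins together with their three
   common neighbours span a K_{3,3}. *)
have n3 j : n j = 3%N by case: (n23 j) (no2 j) => ->.
have [j _] : exists j : J, true.
  move: d_gt0; rewrite -sum_n lt0n sum_nat_eq0 => /forallPn[j _]; by exists j.
have d3 : d = 3%N.
  by rewrite -sum_n (bigD1 j) //= big1 ?n3 // => i; rewrite (n3_unique (n3 i) (n3 j)) eqxx.
split=> //.
have := optimal_none_degree j g1; rewrite n3 part_degreeE.
set B := [set y | _ & _]%SET => cB.
pose f (z : complete_bipartite 3 3) : G := match z with
  | inl i => nth v1 [:: v1; v2; v3] i
  | inr i => nth v1 (enum B) i end.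
have sB : size (enum B) = 3%N by rewrite -cardE.
have fB (i : 'I_3) : f (inr i) \in B by rewrite -mem_enum mem_nth // sB.
have fV (i : 'I_3) : f (inl i) \in [:: v1; v2; v3] by rewrite mem_nth.
have cross i k : adj (f (inl i)) (f (inr k)).
  by rewrite tw //; have := fB k; rewrite inE => /andP[].
exists f; split=> [[i|i] [k|k] //= eq_f|[i|i] [k|k] //= _].
- by congr inl; apply/ord_inj/eqP; rewrite -(nth_uniq v1 (s := [:: v1; v2; v3])) // eq_f.
- by have := cross i k; rewrite /= eq_f adj_irrefl.
- by have := cross k i; rewrite /= eq_f adj_irrefl.
- by congr inr; apply/ord_inj/eqP; rewrite -(nth_uniq v1 (s := enum B)) ?sB ?enum_uniq // eq_f.
- exact: cross.
- by rewrite adj_sym; apply: cross.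
Qed.

End Partition.

Import Order.TTheory GRing.Theory Num.Theory.
Local Open Scope ring_scope.

(** * Conditions that hold off the roots of a nonzero polynomial *)

Section Cofinite.
Variable R : realType.

(** With a polynomial as witness, a finite conjunction of conditions is witnessed by a product. *)
Definition cofinite (P : R -> Prop) :=
  exists2 f : {poly R}, f != 0 & forall t, f.[t] != 0 -> P t.

Lemma cofinite_exists P : cofinite P -> exists t, P t.
Proof.
move=> [f f0 fP]; apply: contrapT => noP.
(* There are [size f] candidates, one more than the number of roots that [f] can have. *)
pose ts := [seq i%:R : R | i <- iota 0 (size f)].
have uts : uniq ts by rewrite map_inj_uniq ?iota_uniq //; exact: (mulrIn (oner_neq0 R)).
suff /max_poly_roots/(_ uts) : all (root f) ts.
  by move=> /(_ f0); rewrite size_map size_iota ltnn.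
apply/allP => t _; apply: contraT => ft.
by case: noP; exists t; apply: fP.
Qed.

Lemma cofinite_mono (P Q : R -> Prop) : (forall t, P t -> Q t) -> cofinite P -> cofinite Q.
Proof. by move=> PQ [f f0 fP]; exists f => // t /fP /PQ. Qed.

Lemma cofinite_and P Q : cofinite P -> cofinite Q -> cofinite (fun t => P t /\ Q t).
Proof.
move=> [f f0 fP] [h h0 hQ]; exists (f * h); first by rewrite mulf_neq0.
by move=> t; rewrite hornerM mulf_eq0 negb_or => /andP[/fP ? /hQ].
Qed.

Lemma cofinite_true (P : R -> Prop) : (forall t, P t) -> cofinite P.
Proof. by exists 1 => //; rewrite oner_neq0. Qed.

Lemma cofinite_forall (K : finType) (P : K -> R -> Prop) :
  (forall k, cofinite (P k)) -> cofinite (fun t => forall k, P k t).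
Proof.
move=> coP; have /choice[f fP] : forall k, exists f : {poly R},
    f != 0 /\ forall t, f.[t] != 0 -> P k t by move=> k; have [f] := coP k; exists f.
exists (\prod_k f k); first by apply/prodf_neq0 => k _; have [] := fP k.
by move=> t; rewrite horner_prod => /prodf_neq0 fk k; have [_] := fP k; apply; apply: fk.
Qed.

Lemma cofinite_imply (A : Prop) (P : R -> Prop) :
  (A -> cofinite P) -> cofinite (fun t => A -> P t).
Proof.
case: (pselect A) => [a /(_ a)|na _]; last exact: cofinite_true.
by apply: cofinite_mono.
Qed.

Lemma cofinite_quadratic (a b c : R) : [|| a != 0, b != 0 | c != 0] ->
  cofinite (fun t => a + b * t + c * t ^+ 2 != 0).
Proof.
move=> abc; exists (a%:P + b *: 'X + c *: 'X^2).
  apply: contraTneq abc => f0.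
  have := congr1 (fun f : {poly R} => f`_0) f0; have := congr1 (fun f : {poly R} => f`_1) f0.
  have := congr1 (fun f : {poly R} => f`_2) f0; rewrite !coefE /= => c0 b0 a0.
  by rewrite negb_or negb_or !negbK; apply/and3P; split; apply/eqP; lra.
by move=> t; rewrite !hornerE.
Qed.

End Cofinite.

(** * Vector geometry in 3-space *)

Section Space.
Variable R : realType.

(** Named coordinates reduce every vector identity to three polynomial identities for [ring]. *)
Record vec := Vec { vx : R; vy : R; vz : R }.

Definition dot u v := vx u * vx v + vy u * vy v + vz u * vz v.
Definition cross u v := Vec (vy u * vz v - vz u * vy v)
  (vz u * vx v - vx u * vz v) (vx u * vy v - vy u * vx v).
Definition vscale a u := Vec (a * vx u) (a * vy u) (a * vz u).
Definition vadd u v := Vec (vx u + vx v) (vy u + vy v) (vz u + vz v).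
Definition vopp u := vscale (-1) u.
Definition vzero := Vec 0 0 0.
Definition det u v w := dot (cross u v) w.
(* Orthogonal to the plane through [u], [v], [w]. *)
Definition normal u v w := vadd (vadd (cross u v) (cross v w)) (cross w u).

Lemma vecP u v : vx u = vx v -> vy u = vy v -> vz u = vz v -> u = v.
Proof. by case: u v => [? ? ?] [? ? ?] /= -> -> ->. Qed.

Lemma dotC u v : dot u v = dot v u. Proof. by rewrite /dot; ring. Qed.
Lemma dotZl a u v : dot (vscale a u) v = a * dot u v. Proof. by rewrite /dot /=; ring. Qed.
Lemma dotZr a u v : dot u (vscale a v) = a * dot u v. Proof. by rewrite /dot /=; ring. Qed.
Lemma dotDl u v w : dot (vadd u v) w = dot u w + dot v w. Proof. by rewrite /dot /=; ring. Qed.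
Lemma dotDr u v w : dot u (vadd v w) = dot u v + dot u w. Proof. by rewrite /dot /=; ring. Qed.
Lemma dot0v u : dot vzero u = 0. Proof. by rewrite /dot /=; ring. Qed.
Lemma dotNl u v : dot (vopp u) v = - dot u v. Proof. by rewrite dotZl mulN1r. Qed.
Lemma dotNr u v : dot u (vopp v) = - dot u v. Proof. by rewrite dotZr mulN1r. Qed.
Lemma voppK u : vopp (vopp u) = u. Proof. by apply: vecP => /=; ring. Qed.

Lemma detC u v w : det u v w = det v w u. Proof. by rewrite /det /dot /=; ring. Qed.
Lemma detN u v w : det u v w = - det v u w. Proof. by rewrite /det /dot /=; ring. Qed.

Lemma dot_self_eq0 u : dot u u = 0 -> u = vzero.
Proof.
move=> u0; have := sqr_ge0 (vx u); have := sqr_ge0 (vy u); have := sqr_ge0 (vz u).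
move: u0; rewrite /dot -!expr2 => u0 z0 y0 x0.
by apply: vecP; apply/eqP; rewrite -sqrf_eq0 /=; apply/eqP; lra.
Qed.

Lemma dot_self_gt0 u : u <> vzero -> 0 < dot u u.
Proof.
move=> u0; rewrite lt_neqAle; apply/andP; split.
  by apply/eqP => /esym/dot_self_eq0.
by rewrite /dot -!expr2 !addr_ge0 ?sqr_ge0.
Qed.

Lemma normalize u : u <> vzero -> exists2 a, a != 0 & dot (vscale a u) (vscale a u) = 1.
Proof.
move=> /dot_self_gt0 u0; exists (Num.sqrt (dot u u))^-1.
  by rewrite invr_eq0 sqrtr_eq0 -ltNge.
have /sqr_sqrtr s2 := ltW u0.
rewrite dotZl dotZr -[X in _ * (_ * X)]s2.
have : Num.sqrt (dot u u) != 0 by rewrite sqrtr_eq0 -ltNge.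
by move: (Num.sqrt _) => s s0; field.
Qed.

Lemma vscale_eq0 a u : vscale a u = vzero -> a != 0 -> u = vzero.
Proof.
by case: u => x y z [/eqP + /eqP + /eqP]; rewrite !mulf_eq0 => + + + /negbTE a0; rewrite a0 /=
  => /eqP-> /eqP-> /eqP->.
Qed.

Lemma cross_cross u v w : cross (cross u v) w = vadd (vscale (dot u w) v) (vscale (- dot v w) u).
Proof. by apply: vecP; rewrite /dot /=; ring. Qed.

Lemma cross_eq0 u v : dot u u = 1 -> cross u v = vzero -> v = vscale (dot u v) u.
Proof.
move=> u1 uv0; have /(congr1 vx) := cross_cross u v u.
have /(congr1 vy) := cross_cross u v u; have /(congr1 vz) := cross_cross u v u.
by rewrite uv0 u1 (dotC v u) /= => z0 y0 x0; apply: vecP; rewrite /=; lra.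
Qed.

Lemma cross_scaler a u v : cross u (vscale a v) = vscale a (cross u v).
Proof. by apply: vecP => /=; ring. Qed.

Lemma vec_neq0 u : u <> vzero -> [|| vx u != 0, vy u != 0 | vz u != 0].
Proof.
case: u => x y z /= u0; apply: contraT; rewrite !negb_or !negbK.
by move=> /and3P[/eqP x0 /eqP y0 /eqP z0]; case: u0; rewrite x0 y0 z0.
Qed.

Lemma orthogonal_unit q : dot q q = 1 -> exists2 e, dot e e = 1 & dot q e = 0.
Proof.
move=> q1; have [e e0 qe] : exists2 e, e <> vzero & dot q e = 0.
  case: (eqVneq (vx q) 0) => [x0|x0].
    by exists (Vec 1 0 0); [case=> /eqP; rewrite oner_eq0|rewrite /dot /= x0; ring].
  by exists (Vec (- vy q) (vx q) 0); [case=> _ /eqP; apply/negP|rewrite /dot /=; ring].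
by have [a _ e1] := normalize e0; exists (vscale a e) => //; rewrite dotZr qe mulr0.
Qed.

Lemma one_add_sqr_neq0 (t : R) : 1 + t ^+ 2 != 0.
Proof. by rewrite gt_eqF // ltr_pwDl ?ltr01 ?sqr_ge0. Qed.

(** The rational parametrization of the great circle with pole [q]. The excluded case, [a] parallel
    to [q] and [b = 0], is the one where the plane of equation [dot a x = b] could contain the whole
    circle. *)
Lemma circle_param q : dot q q = 1 -> exists2 p : R -> vec,
  forall t, dot (p t) (p t) = 1 /\ dot q (p t) = 0 &
  forall a b, cross a q <> vzero \/ b <> 0 -> cofinite (fun t => dot a (p t) <> b).
Proof.
move=> q1; have [e e1 qe] := orthogonal_unit q1; pose f := cross q e.
have f1 : dot f f = 1.
  have -> : dot f f = dot q q * dot e e - dot q e ^+ 2 by rewrite /f /dot /=; ring.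
  by rewrite q1 e1 qe; ring.
have ef : dot e f = 0 by rewrite /f /dot /=; ring.
have qf : dot q f = 0 by rewrite /f /dot /=; ring.
have q_cross : q = cross e f.
  have -> : cross e f = vadd (vscale (dot e e) q) (vscale (- dot q e) e).
    by apply: vecP; rewrite /f /dot /=; ring.
  by rewrite e1 qe; apply: vecP => /=; ring.
exists (fun t => vscale (1 + t ^+ 2)^-1 (vadd (vscale (1 - t ^+ 2) e) (vscale (2 * t) f))).
  move=> t; have := one_add_sqr_neq0 t.
  split; rewrite ?(dotZl, dotZr, dotDl, dotDr) ?qe ?qf ?(dotC f e) ?e1 ?f1 ?ef; by field.
move=> a b ab.
(* These are the coefficients of [dot a (p t) - b] after multiplication by [1 + t ^+ 2]. *)
have : [|| dot a e - b != 0, 2 * dot a f != 0 | - (dot a e + b) != 0].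
  apply: contraT; rewrite !negb_or !negbK => /and3P[/eqP z1 /eqP z2 /eqP z3].
  have [ae af b0] : [/\ dot a e = 0, dot a f = 0 & b = 0] by split; lra.
  case: ab => // -[]; rewrite q_cross.
  have -> : cross a (cross e f) = vadd (vscale (dot a f) e) (vscale (- dot a e) f).
    by apply: vecP; rewrite /dot /=; ring.
  by rewrite ae af; apply: vecP => /=; ring.
move=> /cofinite_quadratic; apply: cofinite_mono => t /eqP t0 eb; apply: t0.
have := one_add_sqr_neq0 t; move: eb; rewrite ?(dotZl, dotZr, dotDl, dotDr) => <- s0.
by field.
Qed.

(** The curve is the moment curve (1, t, t^2), normalized. The scaling factor is not polynomial in
    [t], but it does not affect whether a cross product vanishes. *)
Lemma sphere_param : exists2 p : R -> vec, forall t, dot (p t) (p t) = 1 &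
  forall a, a <> vzero -> cofinite (fun t => cross a (p t) <> vzero).
Proof.
have /choice[s sP] : forall t : R, exists a : R, a != 0 /\
    dot (vscale a (Vec 1 t (t ^+ 2))) (vscale a (Vec 1 t (t ^+ 2))) = 1.
  move=> t; have [|a a0 a1] := @normalize (Vec 1 t (t ^+ 2)); last by exists a.
  by case=> /eqP; rewrite oner_eq0.
exists (fun t => vscale (s t) (Vec 1 t (t ^+ 2))) => [t|a /vec_neq0 a0]; first by have [] := sP t.
suff : cofinite (fun t => cross a (Vec 1 t (t ^+ 2)) <> vzero).
  apply: cofinite_mono => t t0; rewrite cross_scaler => /vscale_eq0 st0; apply: t0.
  by apply: st0; have [] := sP t.
(* If [a] is not on the third axis, the third coordinate of the cross product is a nonzero
   polynomial in [t]; otherwise the second coordinate is the nonzero constant [vz a]. *)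
case: (boolP ((vx a != 0) || (vy a != 0))) => [xy|].
  have : [|| - vy a != 0, vx a != 0 | 0 != 0 :> R] by rewrite oppr_eq0 eqxx orbF orbC.
  move=> /cofinite_quadratic; apply: cofinite_mono => t /eqP t0 [_ _ z0]; apply: t0.
  by rewrite -[RHS]z0; ring.
rewrite negb_or !negbK => /andP[/eqP x0 /eqP y0]; apply: cofinite_true => t [_ z0 _].
by move: a0; rewrite x0 y0 eqxx /=; apply/negP; rewrite negbK -z0 x0; apply/eqP; ring.
Qed.

Lemma dot_unit_opp u v : dot u u = 1 -> dot v v = 1 -> cross u v = vzero -> u = v \/ u = vopp v.
Proof.
move=> u1 v1 /(cross_eq0 u1) vu; have := v1; rewrite vu dotZl dotZr u1 mulr1.
move=> /eqP; rewrite -expr2 sqrf_eq1 => /orP[] /eqP ->; [left|right].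
  by apply: vecP => /=; ring.
by apply: vecP => /=; ring.
Qed.

(** A line meets the sphere in at most two points, and [normal u v w] is the cross product of the
    chords from [u] to [v] and from [u] to [w]. *)
Lemma normal_neq0 u v w : dot u u = 1 -> dot v v = 1 -> dot w w = 1 ->
  u <> v -> u <> w -> v <> w -> normal u v w <> vzero.
Proof.
move=> u1 v1 w1 uv uw vw n0.
pose a := vadd v (vopp u); pose b := vadd w (vopp u).
have ua : dot a a = - (2 * dot u a).
  by rewrite /a ?(dotDl, dotDr, dotNl, dotNr) u1 v1 (dotC v u); ring.
have ub : dot b b = - (2 * dot u b).
  by rewrite /b ?(dotDl, dotDr, dotNl, dotNr) u1 w1 (dotC w u); ring.
have ab0 : cross a b = vzero by rewrite -n0; apply: vecP => /=; ring.
have neq0 x : u <> x -> 0 < dot (vadd x (vopp u)) (vadd x (vopp u)).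
  by move=> ux; apply: dot_self_gt0 => -[*]; apply: ux; apply: vecP; lra.
have a0 : 0 < dot a a := neq0 _ uv; have b0 : 0 < dot b b := neq0 _ uw.
(* Parallel chords satisfy (a.a) b = (a.b) a. Pairing with [u] and using [ua] and [ub] yields a.a =
   a.b = b.b, so the chords coincide. *)
have e1 : dot a a * dot u b = dot a b * dot u a.
  have : dot (cross (cross a b) a) u = 0 by rewrite ab0 /dot /=; ring.
  by rewrite cross_cross dotDl !dotZl (dotC b a) (dotC b u) (dotC a u); lra.
have e2 : dot b b * dot u a = dot a b * dot u b.
  have : dot (cross (cross a b) b) u = 0 by rewrite ab0 /dot /=; ring.
  by rewrite cross_cross dotDl !dotZl (dotC b u) (dotC a u); lra.
have f1 : dot b b = dot a b by apply: (mulfI (lt0r_neq0 a0)); rewrite ub [in RHS]ua; lra.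
have f2 : dot a a = dot a b by apply: (mulfI (lt0r_neq0 b0)); rewrite ua [in RHS]ub; lra.
have : dot (vadd a (vopp b)) (vadd a (vopp b)) = 0.
  have -> : dot (vadd a (vopp b)) (vadd a (vopp b)) = dot a a - 2 * dot a b + dot b b.
    by rewrite /dot /=; ring.
  by rewrite f1 f2; ring.
by move=> /dot_self_eq0 [*]; apply: vw; apply: vecP; lra.
Qed.

(* Cramer's rule. *)
Lemma normal_eq n u v w : dot n u = 1 -> dot n v = 1 -> dot n w = 1 ->
  normal u v w = vscale (det u v w) n.
Proof.
move=> nu nv nw; have -> : normal u v w = vadd (vadd (vscale (dot n w) (cross u v))
    (vscale (dot n u) (cross v w))) (vscale (dot n v) (cross w u)).
  by rewrite nu nv nw; apply: vecP => /=; ring.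
by apply: vecP; rewrite /det /dot /=; ring.
Qed.

Lemma dot_normal u v w : dot (normal u v w) u = det u v w.
Proof. by rewrite /det /dot /=; ring. Qed.

End Space.

Import fintype finset.

(** * Placing paths and cycles on the unit sphere *)

Section Placement.
Variables (R : realType) (G : sgraph) (W F : {set G}).
Local Notation vec := (vec R).

Definition two_neighbors (S : {set G}) (a : G) :=
  exists b c, [/\ b \in S, c \in S, b != c, adj a b & adj a c].

Hypothesis W_degree : forall a b c e : G, a \in W -> b \in W -> c \in W -> e \in W ->
  adj a b -> adj a c -> adj a e -> b != c -> c != e -> b != e -> False.
Hypothesis F_core : forall S : {set G}, S \subset W ->
  (forall s, s \in S -> two_neighbors S s) -> forall s, s \in S -> s \notin F.

Definition triangle (T : {set G}) :=
  #|T| = 3%N /\ forall a b, a \in T -> b \in T -> a != b -> adj a b.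

(** The vector [w] attached to a vertex of the independent part defines an affine plane of equation
    [dot w x = 1] through its three neighbours. [placed_det] provides this plane, while
    [placed_coplanar] and [placed_triangle] let it determine the neighbourhood. The first two are
    only asked when [F] is met, since the closing vertex of a cycle is not generic; triples avoiding
    [F] will be triangles. *)
Record placed (S : {set G}) (pos : G -> vec) : Prop := Placed {
  placed_unit : forall a, a \in S -> dot (pos a) (pos a) = 1;
  placed_inj : forall a b, a \in S -> b \in S -> pos a = pos b -> a = b;
  placed_orth : forall a b, a \in S -> b \in S -> (dot (pos a) (pos b) = 0 <-> adj a b);
  placed_opp : forall a b, a \in S -> b \in S -> pos a = vopp (pos b) -> two_neighbors S a;
  placed_det : forall a b c, a \in S -> b \in S -> c \in S -> a != b -> b != c -> a != c ->
    pos a <> vopp (pos b) -> pos b <> vopp (pos c) -> pos a <> vopp (pos c) ->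
    [|| a \in F, b \in F | c \in F] -> det (pos a) (pos b) (pos c) <> 0;
  placed_coplanar : forall a b c e n, a \in S -> b \in S -> c \in S -> e \in S ->
    uniq [:: a; b; c; e] -> has (mem F) [:: a; b; c; e] ->
    dot n (pos a) = 1 -> dot n (pos b) = 1 -> dot n (pos c) = 1 -> dot n (pos e) = 1 -> False;
  placed_triangle : forall T T' n, triangle T -> triangle T' -> T \subset S -> T' \subset S ->
    (forall a, a \in T -> dot n (pos a) = 1) -> (forall a, a \in T' -> dot n (pos a) = 1) ->
    T = T' }.

Lemma card3_elements (T : {set G}) : #|T| = 3%N -> exists a b c,
  [/\ T = [set a; b; c], a != b, b != c & a != c].
Proof.
rewrite cardE; case E: (enum T) => [|a [|b [|c [|]]]] //= _.
have := enum_uniq T; rewrite E /= !inE negb_or andbT => /andP[/andP[ab ac] bc].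
exists a, b, c; split=> //; apply/setP => x.
by rewrite -mem_enum E !inE orbA.
Qed.

Definition update (pos : G -> vec) p u := fun v => if v == p then u else pos v.

Lemma updateE pos p u : update pos p u p = u.
Proof. by rewrite /update eqxx. Qed.

Lemma update_neq pos p u v : v != p -> update pos p u v = pos v.
Proof. by rewrite /update => /negbTE ->. Qed.

Lemma two_neighbors_sub (S S' : {set G}) a :
  S \subset S' -> two_neighbors S a -> two_neighbors S' a.
Proof. by move=> /subsetP sub [b [c [bS cS]]]; exists b, c; split; auto. Qed.

(** Apart from the forced orthogonality to placed neighbours, [u] avoids the great circles and
    points that would spoil [placed]: values 1 and -1 mean equal and antipodal points, and
    [generic_normal] says that [u] is off the affine plane through three placed points. *)
Record generic (S : {set G}) (pos : G -> vec) (p : G) (u : vec) : Prop := Generic {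
  generic_unit : dot u u = 1;
  generic_nbr : forall r, r \in S -> adj p r -> dot (pos r) u = 0;
  generic_orth : forall r, r \in S -> ~~ adj p r -> dot (pos r) u <> 0;
  generic_eq : forall r, r \in S -> dot (pos r) u <> 1 /\ dot (pos r) u <> -1;
  generic_det : forall a b, a \in S -> b \in S -> a != b -> pos a <> vopp (pos b) ->
    det (pos a) (pos b) u <> 0;
  generic_normal : forall a b c, a \in S -> b \in S -> c \in S ->
    a != b -> b != c -> a != c ->
    dot (normal (pos a) (pos b) (pos c)) u <> det (pos a) (pos b) (pos c) }.

Lemma generic_plane S pos p u a b c n : generic S pos p u ->
  a \in S -> b \in S -> c \in S -> a != b -> b != c -> a != c ->
  dot n (pos a) = 1 -> dot n (pos b) = 1 -> dot n (pos c) = 1 -> dot n u = 1 -> False.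
Proof.
move=> gen aS bS cS ab bc ac na nb nc nu; apply: (generic_normal gen aS bS cS) => //.
by rewrite (normal_eq na nb nc) dotZl nu mulr1.
Qed.

Definition one_neighbor (S : {set G}) p := forall b c, b \in S -> c \in S ->
  adj p b -> adj p c -> b = c.

(** The other two vertices of a triangle at [p] would be two distinct neighbours of [p] in [S]. *)
Lemma no_triangle_at S p T : one_neighbor S p -> triangle T -> T \subset p |: S -> p \notin T.
Proof.
move=> one tT TS; apply/negP => pT.
have [_ clT] := tT; have [a [b [c [eT ab bc ac]]]] := card3_elements (proj1 tT).
have nbr x : x \in T -> x != p -> x \in S /\ adj p x.
  move=> xT xp; split; last by apply: clT => //; rewrite eq_sym.
  by have := subsetP TS x xT; rewrite !inE (negbTE xp).
have aT : a \in T by rewrite eT !inE eqxx.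
have bT : b \in T by rewrite eT !inE eqxx orbT.
have cT : c \in T by rewrite eT !inE eqxx orbT.
have same x y : x \in T -> y \in T -> x != p -> y != p -> x = y.
  by move=> xT yT /(nbr _ xT)[xS px] /(nbr _ yT)[yS py]; apply: one.
case: (eqVneq a p) => [ap|ap].
  by move: bc; rewrite (same b c) ?eqxx // -ap eq_sym.
case: (eqVneq b p) => [bp|bp]; first by move: ac; rewrite (same a c) ?eqxx // -bp eq_sym.
by move: ab; rewrite (same a b) ?eqxx.
Qed.

(** Configurations containing [p] are handled by the corresponding clause of [generic]; no new
    triangle appears because [p] has at most one neighbour in [S]. *)
Lemma placed_extend S pos p u : placed S pos -> S \subset W -> p \in W -> p \notin S ->
  one_neighbor S p -> generic S pos p u -> placed (p |: S) (update pos p u).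
Proof.
move=> plS SW pW pS one gen.
have old v : v \in S -> update pos p u v = pos v.
  by move=> vS; apply: update_neq; apply: contraNneq pS => <-.
have newu : update pos p u p = u by rewrite updateE.
have sub : S \subset p |: S by apply/subsetP => v; rewrite !inE orbC => ->.
have split2 a : a \in p |: S -> a = p \/ a \in S.
  by rewrite !inE => /orP[/eqP|]; auto.
have neqNu r : r \in S -> pos r <> u /\ pos r <> vopp u.
  move=> rS; have [r1 rN] := generic_eq gen rS; have u1 := generic_unit gen.
  by split=> e; [apply: r1|apply: rN]; rewrite e ?dotNl u1.
split.
- by move=> a /split2[->|aS]; rewrite ?newu ?(generic_unit gen) ?old ?(placed_unit plS).
- move=> a b /split2[->|aS] /split2[->|bS]; rewrite ?newu ?old //.
  + by move=> e; have [] := neqNu b bS; rewrite e.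
  + by move=> e; have [] := neqNu a aS; rewrite e.
  + exact: (placed_inj plS).
- have new b : b \in S -> (dot (pos b) u = 0 <-> adj p b).
    move=> bS; split=> [/eqP b0|]; last exact: (generic_nbr gen).
    by apply: contraT => /(generic_orth gen bS); move/eqP: b0.
  move=> a b /split2[->|aS] /split2[->|bS]; rewrite ?newu ?old //.
  + by rewrite adj_irrefl (generic_unit gen); split=> // /eqP; rewrite oner_eq0.
  + by rewrite dotC; apply: new.
  + by rewrite adj_sym; apply: new.
  + exact: (placed_orth plS).
- have uN : u <> vopp u.
    move=> /(congr1 (dot u)); rewrite dotNr (generic_unit gen); lra.
  move=> a b /split2[->|aS] /split2[->|bS]; rewrite ?newu ?old //.
  + by move=> e; have [_ []] := neqNu b bS; rewrite e voppK.
  + by move=> e; have [_ []] := neqNu a aS.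
  + by move=> e; apply: two_neighbors_sub sub _; apply: placed_opp plS _ _ aS bS e.
- move=> a b c /split2[->|aS] /split2[->|bS] /split2[->|cS]; rewrite ?newu ?old ?eqxx //.
  + by move=> _ bc _ _ bNc _ _; rewrite detC; apply: (generic_det gen).
  + by move=> _ _ ac _ _ aNc _; rewrite detC detC detN => /eqP; rewrite oppr_eq0 => /eqP;
      apply: (generic_det gen).
  + by move=> ab _ _ aNb _ _ _; apply: (generic_det gen).
  + exact: (placed_det plS).
- move=> a b c e n /split2[->|aS] /split2[->|bS] /split2[->|cS] /split2[->|eS];
    rewrite ?newu ?old //= !inE ?eqxx ?orbT ?negb_or ?andbF // andbT.
  + move=> /and3P[_ /andP[bc be] ce] _ nu nb nc ne.
        exact: (generic_plane gen bS cS eS bc ce be nb nc ne nu).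
  + move=> /and3P[/and3P[ab ac ae] _ ce] _ na nu nc ne.
    exact: (generic_plane gen aS cS eS ac ce ae na nc ne nu).
  + move=> /and3P[/and3P[ab ac ae] /andP[bc be] _] _ na nb nu ne.
    exact: (generic_plane gen aS bS eS ab be ae na nb ne nu).
  + move=> /and3P[/and3P[ab ac ae] /andP[bc be] _] _ na nb nc nu.
    exact: (generic_plane gen aS bS cS ab bc ac na nb nc nu).
  + move=> /and3P[/and3P[ab ac ae] /andP[bc be] ce] hF na nb nc ne.
    apply: (placed_coplanar plS aS bS cS eS _ _ na nb nc ne) => //=.
    by rewrite !inE !negb_or ab ac ae bc be ce.
- have inS T : triangle T -> T \subset p |: S -> T \subset S.
    move=> tT TS; have pT := no_triangle_at one tT TS.
    apply/subsetP => v vT; have /split2[vp|//] := subsetP TS v vT.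
    by rewrite -vp vT in pT.
  move=> T T' n tT tT' /(inS _ tT) TS /(inS _ tT') TS' nT nT'.
  apply: (placed_triangle plS tT tT' TS TS' (n := n)) => a aT.
    by rewrite -old ?nT // (subsetP TS).
  by rewrite -old ?nT' // (subsetP TS').
Qed.

(* [p] can be placed on the great circle with pole [q]. *)
Definition good_pole (S : {set G}) (pos : G -> vec) p q :=
  [/\ dot q q = 1, forall r, r \in S -> adj p r -> pos r = q,
      forall r, r \in S -> ~~ adj p r -> cross (pos r) q <> @vzero R,
      forall a b, a \in S -> b \in S -> a != b -> pos a <> vopp (pos b) ->
        cross (cross (pos a) (pos b)) q <> @vzero R &
      forall a b c, a \in S -> b \in S -> c \in S -> a != b -> b != c -> a != c ->
        cross (normal (pos a) (pos b) (pos c)) q <> @vzero R \/ det (pos a) (pos b) (pos c) <> 0].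

(** Each inequality of [generic] is an avoidance condition of [circle_param], and [good_pole]
    collects what makes these conditions nondegenerate. For the values 1 and -1 a nonzero right-hand
    side suffices. *)
Lemma generic_exists S pos p q : good_pole S pos p q -> exists u, generic S pos p u.
Proof.
move=> [q1 nbr orth dets normals].
have [P P1 Pgen] := circle_param q1.
suff : cofinite (fun t => [/\ forall r, r \in S -> ~~ adj p r -> dot (pos r) (P t) <> 0,
  forall r, r \in S -> dot (pos r) (P t) <> 1 /\ dot (pos r) (P t) <> -1,
  forall a b, a \in S -> b \in S -> a != b -> pos a <> vopp (pos b) ->
    det (pos a) (pos b) (P t) <> 0 &
  forall a b c, a \in S -> b \in S -> c \in S -> a != b -> b != c -> a != c ->
    dot (normal (pos a) (pos b) (pos c)) (P t) <> det (pos a) (pos b) (pos c)]).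
  move=> /cofinite_exists[t [g1 g2 g3 g4]]; exists (P t); have [Pt qPt] := P1 t; split=> //.
  by move=> r rS pr; rewrite (nbr r).
suff : cofinite (fun t => (forall r, r \in S -> ~~ adj p r -> dot (pos r) (P t) <> 0) /\
  (forall r, r \in S -> dot (pos r) (P t) <> 1 /\ dot (pos r) (P t) <> -1) /\
  (forall a b, a \in S -> b \in S -> a != b -> pos a <> vopp (pos b) ->
    det (pos a) (pos b) (P t) <> 0) /\
  forall a b c, a \in S -> b \in S -> c \in S -> a != b -> b != c -> a != c ->
    dot (normal (pos a) (pos b) (pos c)) (P t) <> det (pos a) (pos b) (pos c)).
  by apply: cofinite_mono => t [? [? []]].
apply: cofinite_and; last apply: cofinite_and; last apply: cofinite_and.
- apply: cofinite_forall => r; apply: cofinite_imply => rS; apply: cofinite_imply => pr.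
  by apply: Pgen; left; apply: orth.
- apply: cofinite_forall => r; apply: cofinite_imply => rS.
  by apply: cofinite_and; apply: Pgen; right => /eqP; rewrite ?oppr_eq0 oner_eq0.
- apply: cofinite_forall => a; apply: cofinite_forall => b.
  apply: cofinite_imply => aS; apply: cofinite_imply => bS; apply: cofinite_imply => ab.
  by apply: cofinite_imply => aNb; apply: Pgen; left; apply: dets.
apply: cofinite_forall => a; apply: cofinite_forall => b; apply: cofinite_forall => c.
apply: cofinite_imply => aS; apply: cofinite_imply => bS; apply: cofinite_imply => cS.
apply: cofinite_imply => ab; apply: cofinite_imply => bc; apply: cofinite_imply => ac.
by apply: Pgen; apply: normals.
Qed.

Lemma cross_neq0 S pos a b : placed S pos -> a \in S -> b \in S -> a != b ->
  pos a <> vopp (pos b) -> cross (pos a) (pos b) <> @vzero R.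
Proof.
move=> pl aS bS /eqP ab aNb /dot_unit_opp[]; rewrite ?(placed_unit pl) //.
by move=> /(placed_inj pl aS bS).
Qed.

Lemma placed_normal_neq0 S pos a b c : placed S pos -> a \in S -> b \in S -> c \in S ->
  a != b -> b != c -> a != c -> normal (pos a) (pos b) (pos c) <> @vzero R.
Proof.
move=> pl aS bS cS /eqP ab /eqP bc /eqP ac.
by apply: normal_neq0; rewrite ?(placed_unit pl) // => /(placed_inj pl); auto.
Qed.

(** With no placed neighbour the pole itself is free, and it is taken generic on the curve of
    [sphere_param]. *)
Lemma good_pole_free S pos p : placed S pos -> (forall r, r \in S -> ~~ adj p r) ->
  exists q, good_pole S pos p q.
Proof.
move=> pl free; have [P P1 Pgen] := sphere_param R.
suff : cofinite (fun t => (forall r, r \in S -> cross (pos r) (P t) <> @vzero R) /\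
  (forall a b, a \in S -> b \in S -> a != b -> pos a <> vopp (pos b) ->
    cross (cross (pos a) (pos b)) (P t) <> @vzero R) /\
  forall a b c, a \in S -> b \in S -> c \in S -> a != b -> b != c -> a != c ->
    cross (normal (pos a) (pos b) (pos c)) (P t) <> @vzero R).
  move=> /cofinite_exists[t [g1 [g2 g3]]]; exists (P t); split=> //.
  - by move=> r rS; rewrite (negbTE (free r rS)).
  - by move=> r rS _; apply: g1.
  - by move=> a b c aS bS cS ab bc ac; left; apply: g3.
apply: cofinite_and; last apply: cofinite_and.
- apply: cofinite_forall => r; apply: cofinite_imply => rS; apply: Pgen => r0.
  by have := placed_unit pl rS; rewrite r0 dot0v => /esym/eqP; rewrite oner_eq0.
- apply: cofinite_forall => a; apply: cofinite_forall => b.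
  apply: cofinite_imply => aS; apply: cofinite_imply => bS; apply: cofinite_imply => ab.
  by apply: cofinite_imply => aNb; apply: Pgen; apply: (cross_neq0 pl aS bS ab aNb).
apply: cofinite_forall => a; apply: cofinite_forall => b; apply: cofinite_forall => c.
apply: cofinite_imply => aS; apply: cofinite_imply => bS; apply: cofinite_imply => cS.
apply: cofinite_imply => ab; apply: cofinite_imply => bc; apply: cofinite_imply => ac.
by apply: Pgen; apply: (placed_normal_neq0 pl).
Qed.

(** Here the pole is forced. Since [q] has the neighbour [p] outside [S], it has at most one in [S],
    so at most one placed point is orthogonal to [pos q]; each degeneracy would produce two. *)
Lemma good_pole_neighbor S pos p q : placed S pos -> S \subset W -> p \in W -> p \notin S ->
  one_neighbor S p -> q \in S -> adj p q -> good_pole S pos p (pos q).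
Proof.
move=> pl SW pW pS one qS pq.
have inW v : v \in S -> v \in W by apply: subsetP.
have two a b : a \in S -> b \in S -> a != b -> adj q a -> adj q b -> False.
  move=> aS bS ab qa qb; apply: (@W_degree q a b p);
    rewrite ?(adj_sym q p) ?(inW q) ?(inW a) ?(inW b) //.
    by apply: contraNneq pS => <-.
  by apply: contraNneq pS => <-.
have two_orth a b : a \in S -> b \in S -> a != b ->
    dot (pos a) (pos q) = 0 -> dot (pos b) (pos q) = 0 -> False.
  move=> aS bS ab /(placed_orth pl aS qS) aq /(placed_orth pl bS qS) bq.
  by apply: (two a b) => //; rewrite adj_sym.
have q1 := placed_unit pl qS.
have noN r : r \in S -> pos q <> vopp (pos r).
  by move=> rS /(placed_opp pl qS rS)[b [c [bS cS bc qb qc]]]; apply: (two b c).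
split=> //.
- by move=> r rS pr; rewrite (one r q).
- move=> r rS pr /dot_unit_opp[|//||rN]; rewrite ?(placed_unit pl) //.
    by move=> /(placed_inj pl rS qS) rq; rewrite rq pq in pr.
  by apply: (noN r); rewrite // rN voppK.
- move=> a b aS bS ab aNb; rewrite cross_cross => ab0.
  have c0 := cross_neq0 pl aS bS ab aNb.
  have scale0 s : vscale s (cross (pos a) (pos b)) = @vzero R -> s = 0.
    by move=> e; apply: contrapT => /eqP s0; apply: c0; apply: vscale_eq0 e s0.
  (* The relation [ab0] is a linear dependence between [pos a] and [pos b]; crossing it with either
     of them isolates one coefficient. *)
  apply: (two_orth a b) => //; apply: scale0.
    have -> : vscale (dot (pos a) (pos q)) (cross (pos a) (pos b)) =
      cross (pos a) (vadd (vscale (dot (pos a) (pos q)) (pos b))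
                         (vscale (- dot (pos b) (pos q)) (pos a))).
      by apply: vecP => /=; ring.
    by rewrite ab0; apply: vecP => /=; ring.
  have -> : vscale (dot (pos b) (pos q)) (cross (pos a) (pos b)) =
      cross (pos b) (vadd (vscale (dot (pos a) (pos q)) (pos b))
                         (vscale (- dot (pos b) (pos q)) (pos a))).
    by apply: vecP => /=; ring.
  by rewrite ab0; apply: vecP => /=; ring.
move=> a b c aS bS cS ab bc ac; have n0 := placed_normal_neq0 pl aS bS cS ab bc ac.
(* If the determinant vanishes, the normal is orthogonal to all three points; were it also parallel
   to [pos q], they would be orthogonal to [pos q]. *)
case: (pselect (det (pos a) (pos b) (pos c) = 0)) => [d0|]; last by right.
left=> nq; set n := normal _ _ _ in n0 nq.
have orth v : dot n v = 0 -> dot v (pos q) = 0.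
  move=> nv; apply: contrapT => /eqP vq; apply: n0; apply: (@vscale_eq0 _ (dot v (pos q))) => //.
  have := cross_cross n (pos q) v; rewrite nq nv (dotC (pos q)) => e.
  move: (congr1 (@vx R) e) (congr1 (@vy R) e) (congr1 (@vz R) e); rewrite /= => ex ey ez.
  by apply: vecP; rewrite /=; lra.
apply: (two_orth a b) => //; apply: orth; rewrite /n.
  by rewrite dot_normal.
have -> : normal (pos a) (pos b) (pos c) = normal (pos b) (pos c) (pos a).
  by apply: vecP => /=; ring.
by rewrite dot_normal -detC.
Qed.

Lemma generic_one_neighbor S pos p : placed S pos -> S \subset W -> p \in W -> p \notin S ->
  one_neighbor S p -> exists u, generic S pos p u.
Proof.
move=> pl SW pW pS one; case: (pickP [pred q in S | adj p q]) => [q /andP[qS pq]|free].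
  exact: generic_exists (good_pole_neighbor pl SW pW pS one qS pq).
have [r rS|q /generic_exists //] := @good_pole_free S pos p pl.
by have := free r; rewrite /= rS /= => ->.
Qed.

(* [z] closes the cycle through its neighbours [x] and [y]; it is placed at the
   cross product of their positions. *)
Lemma placed_close S pos u x y z q : placed S pos -> generic S pos y u ->
  S \subset W -> y \in W -> y \notin S -> z \notin y |: S ->
  x \in S -> q \in S -> adj y q -> adj z y -> adj z x ->
  one_neighbor S y -> one_neighbor S z -> ~~ adj q x ->
  (forall r, r \in S -> pos r <> vopp (pos x)) ->
  (forall s, s \in z |: (y |: S) -> s \notin F) ->
  exists pos', placed (z |: (y |: S)) pos'.
Proof.
move=> pl gen SW yW yS zS1 xS qS yq zy zx oney onez qx xN noF.
have pl1 := placed_extend pl SW yW yS oney gen.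
set S1 := y |: S in zS1 pl1 noF *; set pos1 := update pos y u in pl1.
have pos1S v : v \in S -> pos1 v = pos v.
  by move=> vS; apply: update_neq; apply: contraNneq yS => <-.
have pos1y : pos1 y = u := updateE pos y u.
have xS1 : x \in S1 by rewrite !inE xS orbT.
have yS1 : y \in S1 by rewrite !inE eqxx.
have x1 := placed_unit pl xS; have u1 := generic_unit gen.
have xu0 : cross (pos x) u <> @vzero R.
  have [xu xNu] := generic_eq gen xS; case/(dot_unit_opp x1 u1) => e.
    by apply: xu; rewrite e.
  by apply: xNu; rewrite e dotNl u1.
have [s s0] := normalize xu0; set w := vscale s _ => w1.
have splitS1 r : r \in S1 -> r = y \/ r \in S by rewrite !inE => /orP[/eqP|]; auto.
have adjz r : r \in S1 -> adj z r = (r == x) || (r == y).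
  move=> /splitS1[->|rS]; first by rewrite zy eqxx orbT.
  have ry : r != y by apply: contraNneq yS => <-.
  rewrite (negbTE ry) orbF; apply/idP/eqP => [zr|->//]; exact: onez.
(* Orthogonality of [r] to [w] is the vanishing of a determinant, excluded by [generic_det] unless
   [r] is [x] or [y]. *)
have wr r : r \in S1 -> (dot (pos1 r) w = 0 <-> adj z r).
  move=> rS1; rewrite dotZr (adjz _ rS1) dotC.
  have -> : dot (cross (pos x) u) (pos1 r) = det (pos x) u (pos1 r) by [].
  case/splitS1: rS1 => [->|rS].
    by rewrite eqxx orbT pos1y; split=> // _; rewrite /det /dot /=; ring.
  have ry : r != y by apply: contraNneq yS => <-.
  rewrite (pos1S _ rS) (negbTE ry) orbF; case: eqVneq => [->|rx].
    by split=> // _; rewrite /det /dot /=; ring.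
  split=> // /eqP; rewrite mulf_eq0 (negbTE s0) /= => /eqP.
  rewrite -detC => d0; case: (generic_det gen rS xS rx (xN r rS)); exact: d0.
have wx : dot (pos x) w = 0 by rewrite dotZr /dot /=; ring.
have wu : dot u w = 0 by rewrite dotZr /dot /=; ring.
(* A placed vertex at [w] or its antipode is orthogonal to both [u] and [pos x]. The first makes it
   the neighbour [q] of [y], and [q] is not adjacent to [x]. *)
have far r : r \in S1 -> pos1 r = w \/ pos1 r = vopp w -> False.
  move=> rS1 rw.
  have rx : dot (pos1 r) (pos x) = 0.
    by case: rw => ->; rewrite ?dotNl dotC wx ?oppr0.
  have ru : dot (pos1 r) u = 0 by case: rw => ->; rewrite ?dotNl dotC wu ?oppr0.
  case/splitS1: rS1 => [ry|rS].
    by move/eqP: ru; rewrite ry pos1y u1 oner_eq0.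
  rewrite pos1S // in rx ru.
  have yr : adj y r.
    by apply: contraT => /(generic_orth gen rS); rewrite ru.
  have rq := oney r q rS qS yr yq; rewrite rq in rx.
  by move/(placed_orth pl qS xS): rx; apply/negP.
have zN v : v \in S1 -> v != z by move=> vS1; apply: contraNneq zS1 => <-.
exists (update pos1 z w).
have old v : v \in S1 -> update pos1 z w v = pos1 v by move=> /zN; apply: update_neq.
have new : update pos1 z w z = w by rewrite updateE.
have sub : S1 \subset z |: S1 by apply/subsetP => v; rewrite in_setU1 orbC => ->.
have split2 a : a \in z |: S1 -> a = z \/ a \in S1.
  by rewrite in_setU1 => /orP[/eqP|]; auto.
(* Hence the determinant and coplanarity clauses are vacuous for the closed set. *)
have Ffree a : a \in z |: S1 -> (a \in F) = false by move=> /noF/negbTE.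
have triz T : triangle T -> T \subset z |: S1 -> z \in T -> T = [set x; y; z].
  move=> [T3 clT] TS zT; have xy : x != y by apply: contraNneq yS => <-.
  apply/eqP; rewrite eqEcard T3; apply/andP; split.
    apply/subsetP => v vT; rewrite !inE; case: (eqVneq v z) => [|vz]; first by rewrite orbT.
    have /split2[vz'|vS1] := subsetP TS v vT; first by rewrite vz' eqxx in vz.
    by rewrite orbF -adjz //; apply: clT; rewrite // eq_sym.
  by apply: leq_trans (leq_card_setU _ _) _; rewrite cards1 cards2; case: (_ != _).
(* A triangle containing [z] contains [y], so its plane passes through [u], whereas [T'] lies in [S]
   and [generic_plane] keeps [u] off its plane. *)
have onlyone T T' n : triangle T -> triangle T' -> T \subset z |: S1 -> T' \subset z |: S1 ->
    (forall a, a \in T -> dot n (update pos1 z w a) = 1) ->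
    (forall a, a \in T' -> dot n (update pos1 z w a) = 1) -> z \in T -> z \notin T' -> False.
  move=> tT tT' TS TS' nT nT' zT zT'.
  have T'S1 : T' \subset S1.
    apply/subsetP => v vT; have /split2[vz|//] := subsetP TS' v vT.
    by rewrite -vz vT in zT'.
  have yT' := no_triangle_at oney tT' T'S1.
  have T'S v : v \in T' -> v \in S.
    by move=> vT; have /splitS1[vy|//] := subsetP T'S1 v vT; rewrite -vy vT in yT'.
  have nS v : v \in T' -> dot n (pos v) = 1.
    by move=> vT; rewrite -pos1S ?T'S // -old ?nT' // (subsetP T'S1).
  have nu : dot n u = 1.
    by rewrite -pos1y -old ?nT // (triz T) // !inE eqxx ?orbT.
  have [a [b [c [eT ab bc ac]]]] := card3_elements (proj1 tT').
  have aT : a \in T' by rewrite eT !inE eqxx.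
  have bT : b \in T' by rewrite eT !inE eqxx orbT.
  have cT : c \in T' by rewrite eT !inE eqxx orbT.
  by apply: (generic_plane gen (T'S a aT) (T'S b bT) (T'S c cT) ab bc ac _ _ _ nu); apply: nS.
split.
- by move=> a /split2[->|aS]; rewrite ?new ?w1 ?old ?(placed_unit pl1).
- move=> a b /split2[->|aS] /split2[->|bS]; rewrite ?new ?old //.
  + by move=> e; case: (far b bS); left.
  + by move=> e; case: (far a aS); left.
  + exact: (placed_inj pl1).
- move=> a b /split2[->|aS] /split2[->|bS]; rewrite ?new ?old //.
  + by rewrite adj_irrefl w1; split=> // /eqP; rewrite oner_eq0.
  + by rewrite dotC; apply: wr.
  + by rewrite adj_sym; apply: wr.
  + exact: (placed_orth pl1).
- move=> a b /split2[->|aS] /split2[->|bS]; rewrite ?new ?old //.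
  + move=> /(congr1 (dot w)); rewrite dotNr w1; lra.
  + by move=> e; case: (far b bS); right; rewrite e voppK.
  + by move=> e; case: (far a aS); right.
  + by move=> e; apply: two_neighbors_sub sub _; apply: placed_opp pl1 _ _ aS bS e.
- by move=> a b c aS bS cS _ _ _ _ _ _; rewrite !Ffree.
- by move=> a b c e n aS bS cS eS _; rewrite /= !Ffree.
move=> T T' n tT tT' TS TS' nT nT'.
case: (boolP (z \in T)) => zT; case: (boolP (z \in T')) => zT'.
- by rewrite (triz T) // (triz T').
- by case: (onlyone T T' n).
- by case: (onlyone T' T n).
have inS (U : {set G}) : U \subset z |: S1 -> z \notin U -> U \subset S1.
  move=> US zU; apply/subsetP => v vU; have /split2[vz|//] := subsetP US v vU.
  by rewrite -vz vU in zU.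
apply: (placed_triangle pl1 tT tT' (inS _ TS zT) (inS _ TS' zT') (n := n)) => a aT.
  by rewrite -old ?nT // (subsetP (inS _ TS zT)).
by rewrite -old ?nT' // (subsetP (inS _ TS' zT')).
Qed.

(* In a 4-cycle the cross product would meet an earlier vertex, so two opposite
   vertices are placed at antipodal points. *)
Lemma placed_antipode S pos x y : placed S pos -> y \notin S -> x \in S ->
  (forall r, r \in S -> adj y r = adj x r) -> two_neighbors S x ->
  (forall r, r \in S -> pos r <> vopp (pos x)) ->
  (forall b c, b \in S -> c \in S -> adj y b -> adj y c -> ~~ adj b c) ->
  (forall s, s \in y |: S -> s \notin F) ->
  placed (y |: S) (update pos y (vopp (pos x))).
Proof.
move=> pl yS xS yx twox xN indep noF.
have old v : v \in S -> update pos y (vopp (pos x)) v = pos v.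
  by move=> vS; apply: update_neq; apply: contraNneq yS => <-.
have new : update pos y (vopp (pos x)) y = vopp (pos x) by rewrite updateE.
have sub : S \subset y |: S by apply/subsetP => v; rewrite in_setU1 orbC => ->.
have split2 a : a \in y |: S -> a = y \/ a \in S.
  by rewrite in_setU1 => /orP[/eqP|]; auto.
have Ffree a : a \in y |: S -> (a \in F) = false by move=> /noF/negbTE.
have x1 := placed_unit pl xS.
have new1 : dot (vopp (pos x)) (vopp (pos x)) = 1 by rewrite dotNl dotNr opprK.
have newr r : r \in S -> (dot (pos r) (vopp (pos x)) = 0 <-> adj y r).
  move=> rS; rewrite yx // adj_sym dotNr; have [p1 p2] := placed_orth pl rS xS.
  by split=> [/eqP|/p2 ->]; rewrite ?oppr0 // oppr_eq0 => /eqP.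
have twoy : two_neighbors (y |: S) y.
  have [b [c [bS cS bc xb xc]]] := twox; exists b, c.
  by split; rewrite ?yx // (subsetP sub).
split.
- by move=> a /split2[->|aS]; rewrite ?new ?new1 ?old ?(placed_unit pl).
- move=> a b /split2[->|aS] /split2[->|bS]; rewrite ?new ?old //.
  + by move=> e; case: (xN b bS).
  + by move=> e; case: (xN a aS).
  + exact: (placed_inj pl).
- move=> a b /split2[->|aS] /split2[->|bS]; rewrite ?new ?old //.
  + by rewrite adj_irrefl new1; split=> // /eqP; rewrite oner_eq0.
  + by rewrite dotC; apply: newr.
  + by rewrite adj_sym; apply: newr.
  + exact: (placed_orth pl).
- move=> a b /split2[->|aS] /split2[->|bS]; rewrite ?new ?old //.
  + by rewrite voppK => /(placed_inj pl aS xS) ->; apply: two_neighbors_sub twox.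
  + by move=> e; apply: two_neighbors_sub sub _; apply: placed_opp pl _ _ aS bS e.
- by move=> a b c aS bS cS _ _ _ _ _ _; rewrite !Ffree.
- by move=> a b c e n aS bS cS eS _; rewrite /= !Ffree.
(* A triangle at [y] would need an edge between two neighbours of [y], against [indep]. *)
have inS T : triangle T -> T \subset y |: S -> T \subset S.
  move=> tT TS; have [_ clT] := tT; apply/subsetP => v vT.
  have /split2[vy|//] := subsetP TS v vT; exfalso; rewrite vy in vT => {v vy}.
  have [a [b [c [eT ab bc ac]]]] := card3_elements (proj1 tT).
  have nbr r : r \in T -> r != y -> r \in S /\ adj y r.
    move=> rT ry; split; last by apply: clT => //; rewrite eq_sym.
    by have /split2[ry'|//] := subsetP TS r rT; rewrite ry' eqxx in ry.
  have no r t : r \in T -> t \in T -> r != y -> t != y -> r != t -> False.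
    move=> rT tT' ry ty rt; have [rS yr] := nbr r rT ry; have [tS yt] := nbr t tT' ty.
    by have := indep r t rS tS yr yt; rewrite clT.
  have aT : a \in T by rewrite eT !inE eqxx.
  have bT : b \in T by rewrite eT !inE eqxx orbT.
  have cT : c \in T by rewrite eT !inE eqxx orbT.
  case: (eqVneq a y) => [ay|ay].
    by case: (no b c); rewrite // -ay eq_sym.
  case: (eqVneq b y) => [by_|by_]; first by case: (no a c); rewrite // -by_ eq_sym.
  by case: (no a b).
move=> T T' n tT tT' /(inS _ tT) TS /(inS _ tT') TS' nT nT'.
apply: (placed_triangle pl tT tT' TS TS' (n := n)) => a aT.
  by rewrite -old ?nT // (subsetP TS).
by rewrite -old ?nT' // (subsetP TS').
Qed.

Lemma two_neighbors_or_one (S : {set G}) p : two_neighbors S p \/ one_neighbor (S :\ p) p.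
Proof.
case: (pselect (two_neighbors S p)) => [|no2]; first by left.
right=> b c /setD1P[_ bS] /setD1P[_ cS] pb pc; apply: contrapT => /eqP bc.
by apply: no2; exists b, c.
Qed.

(** Along a path x, z, y, q of a cycle, the vertices [z] and [y] are removed and the rest is placed
    by induction. If [q] and [x] are not adjacent, which includes the triangle [q = x], then [y] is
    placed generically and [z] closes the cycle; otherwise this is a 4-cycle. *)
Lemma placed_two_regular (S : {set G}) z : S \subset W -> z \in S ->
  (forall s, s \in S -> two_neighbors S s) ->
  (forall S' : {set G}, S' \proper S -> exists pos, placed S' pos) -> exists pos, placed S pos.
Proof.
move=> SW zS reg IH; have noF := F_core SW reg.
have inW v : v \in S -> v \in W by apply: subsetP.
have two a b c e : a \in S -> b \in S -> c \in S -> e \in S ->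
    adj a b -> adj a c -> adj a e -> b != c -> c != e -> b != e -> False.
  by move=> aS bS cS eS; apply: W_degree; apply: inW.
have [x [y [xS yS xy zx zy]]] := reg z zS.
have [q [qS qz yq]] : exists q, [/\ q \in S, q != z & adj y q].
  have [b [c [bS cS bc yb yc]]] := reg y yS.
  case: (eqVneq b z) => [bz|bz]; last by exists b.
  by exists c; split; rewrite // -bz eq_sym.
have yz : y != z by apply: contraTneq zy => ->; rewrite adj_irrefl.
have xz : x != z by apply: contraTneq zx => ->; rewrite adj_irrefl.
have qy : q != y by apply: contraTneq yq => ->; rewrite adj_irrefl.
pose S' := S :\ z :\ y.
have eS : S = z |: (y |: S') by rewrite !finset.setD1K // !inE yz yS.
have S'S v : v \in S' -> [/\ v \in S, v != z & v != y].
  by rewrite !inE => /and3P[].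
have S'W : S' \subset W by apply/subsetP => v /S'S[/inW].
have xS' : x \in S' by rewrite !inE xy xz.
have qS' : q \in S' by rewrite !inE qy qz.
have yS' : y \notin S' by rewrite !inE eqxx.
have zS' : z \notin S' by rewrite !inE eqxx andbF.
have zyS' : z \notin y |: S' by rewrite !inE eqxx andbF orbF eq_sym.
have oney : one_neighbor S' y.
  move=> b c /S'S[bS bz _] /S'S[cS cz _] yb yc; apply: contrapT => /eqP bc.
  by apply: (two y b c z) => //; rewrite adj_sym.
have onez : one_neighbor S' z.
  move=> b c /S'S[bS _ b_y] /S'S[cS _ c_y] zb zc; apply: contrapT => /eqP bc.
  exact: (two z b c y).
have [|pos pl] := IH S'.
  by rewrite eS; apply/properP; split; [apply/subsetP => v; rewrite !inE => ->; rewrite !orbT|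
    exists z; rewrite // !inE eqxx].
(* An antipodal pair would give [x] two neighbours in [S'], besides [z]. *)
have xN r : r \in S' -> pos r <> vopp (pos x).
  move=> rS' e; have e' : pos x = vopp (pos r) by rewrite e voppK.
  have [b [c [/S'S[bS bz _] /S'S[cS cz _] bc xb xc]]] := placed_opp pl xS' rS' e'.
  by apply: (two x b c z) => //; rewrite adj_sym.
case: (boolP (adj q x)) => [qx|qx]; last first.
  have [u gen] := generic_one_neighbor pl S'W (inW y yS) yS' oney.
  rewrite eS; apply: (placed_close pl gen S'W (inW y yS) yS' zyS' xS' qS' yq zy zx) => //.
  by move=> s; rewrite -eS; apply: noF.
(* In the 4-cycle, [z] is placed generically and [y] opposite to [x], both having the neighbours [z]
   and [q]. *)
have [w genw] := generic_one_neighbor pl S'W (inW z zS) zS' onez.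
have plz := placed_extend pl S'W (inW z zS) zS' onez genw.
have eS2 : S = y |: (z |: S') by rewrite finset.setUCA -eS.
have split2 r : r \in z |: S' -> r = z \/ r \in S' by rewrite in_setU1 => /orP[/eqP|]; auto.
have posS v : v \in S' -> update pos z w v = pos v by move=> /S'S[_ vz _]; apply: update_neq.
have q_x : q != x by apply: contraTneq qx => ->; rewrite adj_irrefl.
rewrite eS2; eexists; apply: (@placed_antipode _ _ x y plz).
- by rewrite !inE negb_or yz eqxx.
- by rewrite in_setU1 xS' orbT.
- move=> r /split2[->|rS']; first by rewrite adj_sym zy adj_sym zx.
  have [rS rz r_y] := S'S r rS'; apply/idP/idP => [yr|xr].
    by rewrite (oney r q) // adj_sym.
  case: (eqVneq r q) => [->//|rq]; case: (two x r q z) => //; by rewrite adj_sym.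
- exists z, q; split; rewrite ?in_setU1 ?eqxx ?qS' ?orbT //; by rewrite 1?eq_sym 1?adj_sym.
- move=> r /split2[->|rS']; rewrite (posS x) //; last by rewrite posS //; apply: xN.
  rewrite updateE => e; have := generic_nbr genw xS' zx.
  by rewrite e dotNr (placed_unit pl xS'); lra.
- have nq b : b \in z |: S' -> adj y b -> b = z \/ b = q.
    by move=> /split2[->|bS'] yb; [left|right; apply: oney].
  have zq : ~~ adj z q.
    apply/negP => zq; apply: (two q x y z) => //; by rewrite adj_sym.
  move=> b c bS cS /(nq b bS)[]-> /(nq c cS)[]->; rewrite ?adj_irrefl //.
  by rewrite adj_sym.
by move=> s; rewrite -eS2; apply: noF.
Qed.

(** Induction on the cardinality: a vertex with at most one neighbour in the rest is removed and
    placed last. When there is none, all vertices have two neighbours and [placed_two_regular]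
    applies, so cycles precede paths. *)
Lemma placed_exists (S : {set G}) : S \subset W -> exists pos, placed S pos.
Proof.
have [n] := ubnP #|S|; elim: n S => // n IH S Sn SW.
have IH' (S' : {set G}) : S' \proper S -> exists pos, placed S' pos.
  move=> S'S; apply: IH; first exact: leq_trans (proper_card S'S) _.
  exact: subset_trans (proper_sub S'S) SW.
case: (pselect (exists2 p, p \in S & one_neighbor (S :\ p) p)) => [[p pS one]|no1].
  have S'S : S :\ p \proper S by apply: properD1.
  have [pos pl] := IH' _ S'S; have S'W := subset_trans (proper_sub S'S) SW.
  have pW := subsetP SW p pS; have pS' : p \notin S :\ p by rewrite !inE eqxx.
  have [u gen] := generic_one_neighbor pl S'W pW pS' one.
  rewrite -(finset.setD1K pS); eexists; exact: placed_extend pl S'W pW pS' one gen.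
case: (set_0Vmem S) => [S0|[z zS]].
  have none a : a \notin S by rewrite S0 inE.
  exists (fun _ => @vzero R); split=> a; try by move=> *; have := none a; case/negP.
  move=> T' n' [T3 _] _ aS; have := subset_leq_card aS.
  by rewrite T3 S0 cards0.
apply: (placed_two_regular SW zS) => // s sS.
by case: (two_neighbors_or_one S s) => // one; case: no1; exists s.
Qed.

End Placement.

(* [p] places [P] on the unit sphere, and [w u] is the point of the block
   having inner product 1 with all the neighbours of [u] in [P]. *)
Definition block_frame (R : realType) (G : sgraph) (k : nat) (P I : {set G}) :=
  exists p w : G -> 'I_k -> R,
  [/\ forall x, x \in P -> \sum_i p x i ^+ 2 = 1,
      forall x y, x \in P -> y \in P -> adj x y -> \sum_i p x i * p y i = 0,
      forall x y, x \in P -> y \in P -> p x =1 p y -> x = y,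
      forall u x, u \in I -> x \in P -> adj u x -> \sum_i w u i * p x i = 1 &
      forall u v, u \in I -> v \in I -> w u =1 w v ->
        forall x, x \in P -> adj u x = adj v x].

(** * Blocks that are planes *)

Section PlaneBlock.
Variables (R : realType) (G : sgraph) (P I : {set G}).
Hypothesis P_matching : forall a b c, a \in P -> b \in P -> c \in P ->
  adj a b -> adj a c -> b = c.
Hypothesis I_degree : forall u, u \in I -> #|[set x in P | adj u x]| = 2%N.

(** A line meets the circle in at most two points: by [side], the coordinate along the line has a
    prescribed square, so two of three points share its sign. *)
Lemma circle_three_points (w1 w2 a1 a2 b1 b2 c1 c2 : R) :
  a1 ^+ 2 + a2 ^+ 2 = 1 -> b1 ^+ 2 + b2 ^+ 2 = 1 -> c1 ^+ 2 + c2 ^+ 2 = 1 ->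
  w1 * a1 + w2 * a2 = 1 -> w1 * b1 + w2 * b2 = 1 -> w1 * c1 + w2 * c2 = 1 ->
  [\/ a1 = b1 /\ a2 = b2, a1 = c1 /\ a2 = c2 | b1 = c1 /\ b2 = c2].
Proof.
move=> ua ub uc wa wb wc.
have side x y : x ^+ 2 + y ^+ 2 = 1 -> w1 * x + w2 * y = 1 ->
    (w1 * y - w2 * x) ^+ 2 = w1 ^+ 2 + w2 ^+ 2 - 1.
  move=> u w; have -> : (w1 * y - w2 * x) ^+ 2 =
    (w1 ^+ 2 + w2 ^+ 2) * (x ^+ 2 + y ^+ 2) - (w1 * x + w2 * y) ^+ 2 by ring.
  by rewrite u w; ring.
have w0 : w1 ^+ 2 + w2 ^+ 2 != 0.
  rewrite paddr_eq0 ?sqr_ge0 // !sqrf_eq0; apply/negP => /andP[/eqP z1 /eqP z2].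
  by move: wa; rewrite z1 z2; lra.
have same x y x' y' : w1 * x + w2 * y = 1 -> w1 * x' + w2 * y' = 1 ->
    w1 * y - w2 * x = w1 * y' - w2 * x' -> x = x' /\ y = y'.
  move=> e e' s; split; apply: (mulfI w0).
    have -> : (w1 ^+ 2 + w2 ^+ 2) * x = w1 * (w1 * x + w2 * y) - w2 * (w1 * y - w2 * x) by ring.
    by rewrite e s -e'; ring.
  have -> : (w1 ^+ 2 + w2 ^+ 2) * y = w2 * (w1 * x + w2 * y) + w1 * (w1 * y - w2 * x) by ring.
  by rewrite e s -e'; ring.
have sab : (w1 * a2 - w2 * a1) ^+ 2 == (w1 * b2 - w2 * b1) ^+ 2 by rewrite !side.
have sac : (w1 * a2 - w2 * a1) ^+ 2 == (w1 * c2 - w2 * c1) ^+ 2 by rewrite !side.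
move: sab; rewrite eqf_sqr => /orP[/eqP /(same _ _ _ _ wa wb)|/eqP ab]; first by constructor 1.
move: sac; rewrite eqf_sqr => /orP[/eqP /(same _ _ _ _ wa wc)|/eqP ac]; first by constructor 2.
by constructor 3; apply: same wb wc _; apply: oppr_inj; rewrite -ab -ac.
Qed.

(** In each edge the vertex of larger rank is the quarter turn of the other. Unturned points lie in
    the open first quadrant and turned ones in the open second, so points of different kinds are
    never proportional; points of the same kind have distinct slopes. *)
Lemma plane_placement : exists p1 p2 : G -> R,
  [/\ forall x, p1 x ^+ 2 + p2 x ^+ 2 = 1,
      forall x y, x \in P -> y \in P -> adj x y -> p1 x * p1 y + p2 x * p2 y = 0 &
      forall x y, x \in P -> y \in P -> x != y -> p1 x * p2 y - p2 x * p1 y != 0].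
Proof.
pose mate x := [pick y in P | adj x y && (enum_rank y < enum_rank x)%N].
(* Both ends of an edge use the rank of the lower end; the successor makes the slope positive. *)
pose slope x : R := ((if mate x is Some y then enum_rank y else enum_rank x) : nat).+1%:R.
pose s x : R := (Num.sqrt (1 + slope x ^+ 2))^-1.
have slope_gt0 x : 0 < slope x by rewrite ltr0n.
have s2 x : s x ^+ 2 * (1 + slope x ^+ 2) = 1.
  have pos : 0 < 1 + slope x ^+ 2 by rewrite ltr_pwDl ?ltr01 ?sqr_ge0.
  by rewrite exprVn sqr_sqrtr ?ltW // mulVf ?gt_eqF.
have s0 x : s x != 0.
  by apply: contra_eq_neq (s2 x) => ->; rewrite expr0n /= mul0r eq_sym oner_neq0.
exists (fun x => if mate x then - slope x * s x else s x).
exists (fun x => if mate x then s x else slope x * s x).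
split=> [x|x y xP yP xy|x y xP yP xy].
- by apply: etrans (s2 x); case: (mate x) => [?|] /=; ring.
- wlog rank : x y xP yP xy / (enum_rank x < enum_rank y)%N.
    move=> H; case: (ltngtP (enum_rank x) (enum_rank y)) => [|r|e].
    + exact: H.
    + by rewrite -(H y x) // ?(adj_sym y x) //; ring.
    + by move/ord_inj/enum_rank_inj: e xy => ->; rewrite adj_irrefl.
  have my : mate y = Some x.
    rewrite /mate; case: pickP => [z /and3P[zP yz _]|/(_ x)]; last first.
      by rewrite xP adj_sym xy rank.
    by rewrite (P_matching yP zP xP yz) // adj_sym.
  have mx : mate x = None.
    rewrite /mate; case: pickP => // z /and3P[zP xz zx].
    by move: zx; rewrite (P_matching xP zP yP xz xy) ltnNge ltnW.
  have e : slope y = slope x by rewrite /slope my mx.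
  by rewrite my mx /= e; ring.
have s_neq u v : slope u != slope v -> s u * s v * (slope v - slope u) != 0.
  by move=> uv; rewrite !mulf_neq0 // subr_eq0 eq_sym.
have neq : (mate x : bool) = mate y -> slope x != slope y.
  rewrite eqr_nat eqSS /slope /mate.
  case: pickP => [a /and3P[aP xa _]|_]; case: pickP => [b /and3P[bP yb _]|_] //= _;
    apply: contra_neq xy => /ord_inj/enum_rank_inj // ab.
  by rewrite ab in xa; apply: (P_matching bP); rewrite // adj_sym.
have pos u v : s u * s v * (1 + slope u * slope v) != 0.
  by rewrite !mulf_neq0 // gt_eqF // ltr_pwDl ?ltr01 ?mulr_ge0 ?ltW.
move: neq; case: (mate x) (mate y) => [?|] [?|] /= neq.
- by have := s_neq _ _ (neq erefl); congr (_ != 0); ring.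
- by rewrite -oppr_eq0; have := pos x y; congr (_ != 0); ring.
- by have := pos x y; congr (_ != 0); ring.
- by have := s_neq _ _ (neq erefl); congr (_ != 0); ring.
Qed.

Lemma plane_block : block_frame R 2 P I.
Proof.
have [p1 [p2 [unit orth indep]]] := plane_placement.
have inj x y : x \in P -> y \in P -> p1 x = p1 y -> p2 x = p2 y -> x = y.
  move=> xP yP e1 e2; apply: contrapT => /eqP /(indep _ _ xP yP).
  by rewrite e1 e2 mulrC subrr eqxx.
have /choice[w wP] : forall u, exists w : R * R, u \in I ->
    forall x, x \in P -> adj u x -> w.1 * p1 x + w.2 * p2 x = 1.
  move=> u; case: (boolP (u \in I)) => [uI|]; last by exists (0, 0).
  have /eqP/cards2P[a [b [ab Nab]]] := I_degree uI.
  have N x : (x \in P) && adj u x = (x == a) || (x == b).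
    by have /setP/(_ x) := Nab; rewrite !inE.
  have /andP[aP ua] : (a \in P) && adj u a by rewrite N eqxx.
  have /andP[bP ub] : (b \in P) && adj u b by rewrite N eqxx orbT.
  pose D := p1 a * p2 b - p2 a * p1 b; have D0 : D != 0 by apply: indep.
  (* Cramer's rule for the vector having inner product 1 with both neighbours. *)
  exists ((p2 b - p2 a) / D, (p1 a - p1 b) / D) => _ x xP ux.
  by have := N x; rewrite xP ux /= => /esym/orP[] /eqP ->; rewrite /D /=; field.
pose pt (c : R * R) (i : 'I_2) := if i == ord0 then c.1 else c.2.
exists (fun x => pt (p1 x, p2 x)), (fun u => pt (w u)).
split=> [x _|x y xP yP xy|x y xP yP e|u x uI xP ux|u v uI vI e x xP].
- by rewrite !big_ord_recl big_ord0 addr0 /pt /=.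
- by rewrite !big_ord_recl big_ord0 addr0 /pt /=; apply: orth.
- by apply: inj => //; [have := e ord0|have := e (lift ord0 ord0)].
- by rewrite !big_ord_recl big_ord0 addr0 /pt /=; apply: wP.
have {}e : w u = w v.
  by have := e ord0; have := e (lift ord0 ord0); rewrite /pt;
    case: (w u) (w v) => [? ?] [? ?] /= -> ->.
suff sub u' v' : u' \in I -> v' \in I -> w u' = w v' -> adj u' x -> adj v' x.
  by apply/idP/idP; apply: sub.
move=> uI' vI' e' u'x; apply: contraT => vx.
have /eqP/cards2P[a [b [ab Nab]]] := I_degree vI'.
have N y : (y \in P) && adj v' y = (y == a) || (y == b).
  by have /setP/(_ y) := Nab; rewrite !inE.
have /andP[aP va] : (a \in P) && adj v' a by rewrite N eqxx.
have /andP[bP vb] : (b \in P) && adj v' b by rewrite N eqxx orbT.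
have wx := wP u' uI' x xP u'x; rewrite e' in wx.
(* The line defined by [w v'] already meets the circle at the two neighbours of [v'], so [x] is one
   of them. *)
have [] := circle_three_points (unit a) (unit b) (unit x)
  (wP v' vI' a aP va) (wP v' vI' b bP vb) wx.
- by case=> /(inj _ _ aP bP) /[apply] /eqP; rewrite (negbTE ab).
- by case=> /(inj _ _ aP xP) /[apply] ax; rewrite -ax va in vx.
- by case=> /(inj _ _ bP xP) /[apply] bx; rewrite -bx vb in vx.
Qed.

End PlaneBlock.

(** * The block that is a 3-space *)

Section SpaceBlock.
Variables (R : realType) (G : sgraph) (W I : {set G}).
Hypothesis W_degree : forall a b c e : G, a \in W -> b \in W -> c \in W -> e \in W ->
  adj a b -> adj a c -> adj a e -> b != c -> c != e -> b != e -> False.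
Hypothesis I_degree : forall u, u \in I -> #|[set x in W | adj u x]| = 3%N.
Hypothesis I_swap : forall u x y, u \in I -> x \in W -> y \in W -> adj u x -> adj u y ->
  x != y -> two_neighbors W x -> two_neighbors W y -> adj x y.

Definition two_regular (S : {set G}) :=
  S \subset W /\ forall s, s \in S -> two_neighbors S s.

(* The vertices of the path components. *)
Definition forest := [set x in W | ~~ `[< exists2 S, two_regular S & x \in S >]].

Lemma forest_core (S : {set G}) : S \subset W ->
  (forall s, s \in S -> two_neighbors S s) -> forall s, s \in S -> s \notin forest.
Proof.
move=> SW reg s sS; rewrite inE negb_and negbK; apply/orP; right.
by apply/asboolP; exists S.
Qed.

Lemma not_forest x : x \in W -> x \notin forest -> two_neighbors W x.
Proof.
move=> xW; rewrite inE xW negbK => /asboolP[S [SW reg] xS].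
exact: two_neighbors_sub SW (reg x xS).
Qed.

Lemma set3_cases (a b c s : G) : s \in [set a; b; c] -> [\/ s = a, s = b | s = c].
Proof. by rewrite !inE => /orP[/orP[]|] /eqP->; [constructor 1|constructor 2|constructor 3]. Qed.

(** A neighbourhood either meets the forest, where positions are generic, or is a triangle by
    [I_swap], hence placed at an orthonormal basis. Both cases give a vector [w], and the
    coplanarity clauses recover the neighbourhood from it. *)
Lemma space_block : block_frame R 3 W I.
Proof.
have [pos pl] := placed_exists R W_degree forest_core (subxx W).
pose N u := [set x in W | adj u x].
have NW u x : x \in N u -> x \in W /\ adj u x by rewrite inE => /andP.
have clique u : u \in I -> (forall s, s \in N u -> s \notin forest) -> triangle (N u).
  move=> uI nF; split; first exact: I_degree.
  move=> a b aN bN ab; have [aW ua] := NW u a aN; have [bW ub] := NW u b bN.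
  by apply: (I_swap uI) => //; apply: not_forest => //; apply: nF.
(* Antipodal vertices both have two neighbours in [W], so [I_swap] would make them adjacent, hence
   orthogonal. *)
have noN u a b : u \in I -> a \in N u -> b \in N u -> a != b -> pos a <> vopp (pos b).
  move=> uI aN bN ab e; have [aW ua] := NW u a aN; have [bW ub] := NW u b bN.
  have e' : pos b = vopp (pos a) by rewrite e voppK.
  have := I_swap uI aW bW ua ub ab (placed_opp pl aW bW e) (placed_opp pl bW aW e').
  move/(placed_orth pl aW bW); rewrite e dotNl (placed_unit pl bW); lra.
have /choice[w wP] : forall u, exists n, u \in I ->
    forall x, x \in N u -> dot n (pos x) = 1.
  move=> u; case: (boolP (u \in I)) => [uI|]; last by exists (@vzero R).
  have [a [b [c [eN ab bc ac]]]] := card3_elements (I_degree uI).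
  have aN : a \in N u by rewrite /N eN !inE eqxx.
  have bN : b \in N u by rewrite /N eN !inE eqxx orbT.
  have cN : c \in N u by rewrite /N eN !inE eqxx orbT.
  have [aW _] := NW u a aN; have [bW _] := NW u b bN; have [cW _] := NW u c cN.
  have d0 : det (pos a) (pos b) (pos c) != 0.
    apply/eqP; case: (boolP [|| a \in forest, b \in forest | c \in forest]) => [hF|].
      by apply: (placed_det pl) => //; apply: noN uI _ _ _.
    rewrite !negb_or => /and3P[aF bF cF].
    have [_ cl] : triangle (N u).
      by apply: clique => // s; rewrite /N eN => /set3_cases[]->.
    have orth x y : x \in N u -> y \in N u -> x != y -> dot (pos x) (pos y) = 0.
      move=> xN yN xy; have [xW _] := NW u x xN; have [yW _] := NW u y yN.
      by apply/(placed_orth pl xW yW)/cl.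
    (* The Gram determinant, equal to 1 on an orthonormal triple. *)
    have gram x y z : det x y z ^+ 2 = dot x x * dot y y * dot z z +
        2 * dot x y * dot y z * dot x z - dot x x * dot y z ^+ 2 -
        dot y y * dot x z ^+ 2 - dot z z * dot x y ^+ 2 :> R.
      by rewrite /det /dot /=; ring.
    move=> d0; have := gram (pos a) (pos b) (pos c).
    by rewrite d0 (orth a b) // (orth b c) // (orth a c) // !(placed_unit pl) //; lra.
  exists (vscale (det (pos a) (pos b) (pos c))^-1 (normal (pos a) (pos b) (pos c))) => _ x.
  have nE y : dot (normal (pos a) (pos b) (pos c)) y = det (pos a) (pos b) (pos c) ->
      dot (vscale (det (pos a) (pos b) (pos c))^-1 (normal (pos a) (pos b) (pos c))) y = 1.
    by rewrite dotZl => ->; rewrite mulVf.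
  rewrite /N eN !inE => /orP[/orP[]|] /eqP->; apply: nE; rewrite /normal /det /dot /=; ring.
have share u v : u \in I -> v \in I -> w u = w v -> N u = N v.
  have sub u' v' : u' \in I -> v' \in I -> w u' = w v' ->
      (exists2 s, s \in N v' & s \in forest) -> N u' \subset N v'.
    move=> uI vI e [s sN sF]; apply/subsetP => x xN; apply: contraT => xNv.
    have [a [b [c [eN ab bc ac]]]] := card3_elements (I_degree vI).
    have aN : a \in N v' by rewrite /N eN !inE eqxx.
    have bN : b \in N v' by rewrite /N eN !inE eqxx orbT.
    have cN : c \in N v' by rewrite /N eN !inE eqxx orbT.
    have [aW _] := NW _ a aN; have [bW _] := NW _ b bN; have [cW _] := NW _ c cN.
    have [xW _] := NW _ x xN.
    have neq y : y \in N v' -> y != x by move=> yN; apply: contraNneq xNv => <-.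
    case: (placed_coplanar pl (a := a) (b := b) (c := c) (e := x) (n := w v'));
      rewrite ?(wP v' vI a) ?(wP v' vI b) ?(wP v' vI c) //.
    + by rewrite /= !inE !negb_or ab ac bc !neq.
    + by move: sN; rewrite /N eN => /set3_cases[] <-; rewrite /= sF ?orbT.
    + by rewrite -e wP.
  have eq_card u' v' : u' \in I -> v' \in I -> N u' \subset N v' -> N u' = N v'.
    by move=> uI vI s; apply/eqP; rewrite eqEcard s !I_degree.
  move=> uI vI e.
  case: (pselect (exists2 s, s \in N v & s \in forest)) => [vF|vF].
    exact: eq_card (sub u v uI vI e vF).
  case: (pselect (exists2 s, s \in N u & s \in forest)) => [uF|uF].
    by apply/esym/eq_card => //; apply: sub.
  apply: (placed_triangle pl (n := w u)).
  - by apply: clique => // s sN; apply/negP => sF; apply: uF; exists s.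
  - by apply: clique => // s sN; apply/negP => sF; apply: vF; exists s.
  - by apply/subsetP => s /NW[].
  - by apply/subsetP => s /NW[].
  - by move=> s sN; apply: wP.
  - by move=> s sN; rewrite e; apply: wP.
pose pt (c : vec R) (i : 'I_3) := nth 0 [:: vx c; vy c; vz c] i.
have dotE (a b : vec R) : \sum_i pt a i * pt b i = dot a b.
  by rewrite !big_ord_recl big_ord0 addr0 addrA /pt.
have pt_inj (a b : vec R) : pt a =1 pt b -> a = b.
  by move=> e; apply: vecP; [have := e (@Ordinal 3 0 isT)|have := e (@Ordinal 3 1 isT)|
    have := e (@Ordinal 3 2 isT)].
exists (fun x => pt (pos x)), (fun u => pt (w u)).
split=> [x xW|x y xW yW xy|x y xW yW /pt_inj|u x uI xW ux|u v uI vI /pt_inj e x xW].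
- by rewrite -(placed_unit pl xW) -dotE; apply: eq_bigr => i _; rewrite expr2.
- by rewrite dotE; apply/(placed_orth pl).
- exact: (placed_inj pl).
- by rewrite dotE; apply: wP; rewrite // inE xW.
by have /setP/(_ x) := share u v uI vI e; rewrite !inE xW.
Qed.

End SpaceBlock.

(** * Euclidean distance and the exception in 3-space *)

Lemma euclidean_norm_eq1 (R : realType) (d : nat) (u : 'rV[R]_d) :
  euclidean_norm u = 1 <-> \sum_(i < d) u 0 i ^+ 2 = 1.
Proof.
rewrite /euclidean_norm; split=> [e|->]; last exact: sqrtr1.
rewrite -[LHS]sqr_sqrtr ?e ?expr1n // sumr_ge0 // => i _; exact: sqr_ge0.
Qed.

(** Points equidistant from three points that are not collinear lie on a line, and such a line has
    at most two points at distance 1 from one of the three. *)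
Lemma complete_bipartite33_not_realizable (R : realType) (G : sgraph) :
  contains_subgraph G (complete_bipartite 3 3) -> ~ realizable (R := R) (d := 3) setT G.
Proof.
move=> [f [f_inj f_adj]] [phi [phi_inj _ phi_adj]].
pose pt x := Vec (phi x 0 0) (phi x 0 (inord 1)) (phi x 0 (inord 2)).
have pt_inj x y : pt x = pt y -> x = y.
  case=> e0 e1 e2; apply/phi_inj/rowP => -[[|[|[|//]]] i].
  - by rewrite (_ : Ordinal i = 0) //; apply: val_inj.
  - by rewrite (_ : Ordinal i = inord 1) //; apply: val_inj; rewrite /= inordK.
  - by rewrite (_ : Ordinal i = inord 2) //; apply: val_inj; rewrite /= inordK.
pose a i := pt (f (inl i)); pose b i := pt (f (inr i)).
(* The origin is moved to [b 0], which puts the three points [u i] on the unit sphere. *)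
pose u i := vadd (a i) (vopp (b 0)); pose c i := vadd (b i) (vopp (b 0)).
have dist i j : dot (vadd (u i) (vopp (c j))) (vadd (u i) (vopp (c j))) = 1.
  have /phi_adj/euclidean_norm_eq1 : adj (f (inl i)) (f (inr j)) by apply: f_adj.
  rewrite !big_ord_recl big_ord0 !mxE => <-; rewrite /dot /=.
  rewrite (_ : inord 1 = lift ord0 ord0); last by apply: val_inj; rewrite /= inordK.
  rewrite (_ : inord 2 = lift ord0 (lift ord0 ord0)); last by apply: val_inj; rewrite /= inordK.
  ring.
have c0 : c 0 = @vzero R by apply: vecP => /=; ring.
have u1 i : dot (u i) (u i) = 1.
  by rewrite -(dist i 0) c0; rewrite /dot /=; ring.
have a_neq i j : i != j -> u i <> u j.
  move=> /eqP ij [e1 e2 e3]; apply: ij.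
  have : a i = a j by apply: vecP; rewrite /=; lra.
  by move=> /pt_inj/f_inj[].
have b_neq i j : i != j -> c i <> c j.
  move=> /eqP ij [e1 e2 e3]; apply: ij.
  have : b i = b j by apply: vecP; rewrite /=; lra.
  by move=> /pt_inj/f_inj[].
pose i1 : 'I_3 := inord 1; pose i2 : 'I_3 := inord 2.
have neq01 : 0 != i1 by rewrite -val_eqE /= inordK.
have neq02 : 0 != i2 by rewrite -val_eqE /= inordK.
have neq12 : i1 != i2 by rewrite -val_eqE /= !inordK.
pose n := normal (u 0) (u i1) (u i2).
have n0 : 0 < dot n n.
  by apply/dot_self_gt0/normal_neq0; rewrite ?u1 //; apply: a_neq.
have cu i j : dot (c j) (c j) = 2 * dot (u i) (c j).
  have expand (v t : vec R) : dot (vadd v (vopp t)) (vadd v (vopp t)) =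
      dot v v - 2 * dot v t + dot t t by rewrite /dot /=; ring.
  by have := dist i j; rewrite expand u1; lra.
have ncross j : cross n (c j) = @vzero R.
  have -> : cross n (c j) = vadd
     (vscale (dot (u i1) (c j) - dot (u 0) (c j)) (u i2))
     (vadd (vscale (dot (u i2) (c j) - dot (u i1) (c j)) (u 0))
     (vscale (dot (u 0) (c j) - dot (u i2) (c j)) (u i1))).
    by apply: vecP; rewrite /n /dot /=; ring.
  have e1 : dot (u i1) (c j) = dot (u 0) (c j) by have := cu i1 j; have := cu 0 j; lra.
  have e2 : dot (u i2) (c j) = dot (u 0) (c j) by have := cu i2 j; have := cu 0 j; lra.
  by rewrite e1 e2 subrr; apply: vecP => /=; ring.
have par j : vscale (dot n n) (c j) = vscale (dot n (c j)) n.
  have := cross_cross n (c j) n; rewrite ncross (dotC (c j)) => e.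
  move: (congr1 (@vx R) e) (congr1 (@vy R) e) (congr1 (@vz R) e); rewrite /= => ex ey ez.
  by apply: vecP; rewrite /=; lra.
(* On the axis spanned by [n], the equation c.c = 2 (u.c) has a single nonzero solution, so [c i1]
   and [c i2] coincide. *)
have same j : 0 != j -> dot n (c j) = 2 * dot n (u 0).
  move=> j0; have cj0 : c j <> @vzero R by rewrite -c0; apply: b_neq; rewrite eq_sym.
  have := congr1 (dot (c j)) (par j); have := congr1 (dot (u 0)) (par j).
  rewrite !dotZr (cu 0 j) (dotC (c j) n) (dotC (u 0) n) => e1 e2.
  have nc0 : dot n (c j) != 0.
    apply/eqP => nc0; apply: cj0; apply: vscale_eq0 (_ : vscale (dot n n) _ = _) _.
      by rewrite par nc0; apply: vecP => /=; ring.
    exact: lt0r_neq0.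
  by apply: (mulfI nc0); lra.
apply: (b_neq _ _ neq12).
have e : vscale (dot n n) (c i1) = vscale (dot n n) (c i2) by rewrite !par !same.
move: (lt0r_neq0 n0) => nn0.
by apply: vecP; apply: (mulfI nn0); case: e.
Qed.

(** * Realizations on the line and in rescaled coordinates *)

Lemma degree_le_max (G : sgraph) (x : G) : (degree x <= max_degree G)%N.
Proof. exact: leq_bigmax. Qed.

(** The graph is a matching, and an edge occupies the integers 2k and 2k + 1, where k is the rank of
    its lower end. *)
Lemma realizable_line (R : realType) (G : sgraph) : max_degree G = 1%N ->
  realizable (R := R) (d := 1) setT G.
Proof.
move=> deg1; have one (x y z : G) : adj x y -> adj x z -> y = z.
  move=> xy xz; have := degree_le_max x; rewrite deg1 => /card_le1_eqP.
  by apply; rewrite inE.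
pose mate (x : G) := [pick y | adj x y && (enum_rank y < enum_rank x)%N].
have mateP x y : mate x = Some y -> adj x y.
  by rewrite /mate; case: pickP => // z /andP[xz _] [<-].
pose pos (x : G) : nat := if mate x is Some y then (2 * enum_rank y).+1 else (2 * enum_rank x)%N.
exists (fun x => const_mx (pos x)%:R); split=> // x y.
  move=> /rowP/(_ 0); rewrite !mxE => /eqP; rewrite eqr_nat => /eqP.
  rewrite /pos; case mx : (mate x) => [a|]; case my : (mate y) => [b|] e; [|lia|lia|].
    have ab : a = b by apply/enum_rank_inj/ord_inj; lia.
    by apply: (one a); rewrite adj_sym ?(mateP x) // ab (mateP y).
  by apply/enum_rank_inj/ord_inj; lia.
move=> xy; apply/euclidean_norm_eq1; rewrite big_ord1 !mxE.
wlog rank : x y xy / (enum_rank x < enum_rank y)%N.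
  move=> H; case: (ltngtP (enum_rank x) (enum_rank y)) => [|r|e].
  - exact: H.
  - by apply: etrans (H y x _ r); [ring|rewrite adj_sym].
  - by move/ord_inj/enum_rank_inj: e xy => ->; rewrite adj_irrefl.
have my : mate y = Some x.
  rewrite /mate; case: pickP => [z /andP[yz _]|/(_ x)]; last by rewrite adj_sym xy rank.
  by rewrite (one y z x) // adj_sym.
have mx : mate x = None.
  rewrite /mate; case: pickP => // z /andP[xz].
  by rewrite (one x z y) // ltnNge ltnW.
by rewrite /pos my mx -natr1; ring.
Qed.

(** Rescaling by the inverse of sqrt 2; an arbitrary index type [K] allows coordinates indexed by
    pairs of a block and a position in it. *)
Lemma realizable_coordinates (R : realType) (G : sgraph) (K : finType) (psi : G -> K -> R) :
  (forall x y, psi x =1 psi y -> x = y) ->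
  (forall x y, adj x y -> \sum_k (psi x k - psi y k) ^+ 2 = 2) ->
  realizable (R := R) (d := #|K|) setT G.
Proof.
move=> inj edge; pose s : R := (Num.sqrt 2)^-1.
have s2 : s ^+ 2 * 2 = 1 by rewrite exprVn sqr_sqrtr ?ler0n // mulVf // pnatr_eq0.
have s0 : s != 0 by rewrite invr_eq0 sqrtr_eq0 -ltNge ltr0n.
exists (fun x => \row_i (s * psi x (enum_val i))); split=> // x y.
  move=> /rowP e; apply: inj => k; apply: (mulfI s0).
  by have := e (enum_rank k); rewrite !mxE enum_rankK.
move=> xy; apply/euclidean_norm_eq1; rewrite -s2 -(edge x y xy) mulr_sumr.
rewrite (reindex (@enum_val K predT)) /=; last by apply: onW_bij; apply: enum_val_bij.
by apply: eq_bigr => i _; rewrite !mxE -mulrBr exprMn.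
Qed.

(** * Assembling the blocks and the independent part *)

Section Assembly.
Variables (R : realType) (G : sgraph) (J : finType) (n : J -> nat).
Variable g : {ffun G -> option J}.
Let I := [set x | g x == None].
Hypothesis frames : forall j, block_frame R (n j) [set x | g x == Some j] I.
Hypothesis I_independent : forall u v, u \in I -> v \in I -> adj u v = false.
Hypothesis I_neighbor : forall u, u \in I -> exists x, adj u x.
Hypothesis I_twins : forall u v w, u \in I -> v \in I -> w \in I -> uniq [:: u; v; w] ->
  (forall y, adj u y = adj v y) -> (forall y, adj u y = adj w y) -> False.

(** A vertex [u] of [I] is put at [s u] times the concatenation of its vectors [w], of squared norm
    [Q u]. Its squared distance to a neighbour is 1 + s^2 Q - 2 s, so s must be a root of s^2 Q = 2
    s + 1; the two roots serve the two possible twins. *)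
Lemma realizable_assembly : realizable (R := R) (d := #|{: {j : J & 'I_(n j)}}|) setT G.
Proof.
pose p j := projT1 (cid (frames j)); pose w j := projT1 (cid (projT2 (cid (frames j)))).
have pw j : _ := projT2 (cid (projT2 (cid (frames j)))).
have unit j x : g x = Some j -> \sum_i p j x i ^+ 2 = 1.
  by have [+ _ _ _ _] := pw j => H gx; apply: H; rewrite inE gx.
have orth j x y : g x = Some j -> g y = Some j -> adj x y -> \sum_i p j x i * p j y i = 0.
  by have [_ + _ _ _] := pw j => H gx gy; apply: H; rewrite inE ?gx ?gy.
have inj j x y : g x = Some j -> g y = Some j -> p j x =1 p j y -> x = y.
  by have [_ _ + _ _] := pw j => H gx gy; apply: H; rewrite inE ?gx ?gy.
have wp j u x : g u = None -> g x = Some j -> adj u x -> \sum_i w j u i * p j x i = 1.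
  by have [_ _ _ + _] := pw j => H gu gx; apply: H; rewrite inE ?gu ?gx.
have w_inj j u v : g u = None -> g v = None -> w j u =1 w j v ->
    forall x, g x = Some j -> adj u x = adj v x.
  by have [_ _ _ _ +] := pw j => H gu gv e x gx; apply: (H u v); rewrite ?inE ?gu ?gv ?gx.
pose Q u := \sum_(k : {j : J & 'I_(n j)}) w (tag k) u (tagged k) ^+ 2.
have Q0 u : g u = None -> 0 < Q u.
  move=> gu; have Qge : 0 <= Q u by apply: sumr_ge0 => k _; apply: sqr_ge0.
  rewrite lt_neqAle Qge andbT eq_sym; apply/negP => /eqP.
  move=> /psumr_eq0P => Qz; have uI : u \in I by rewrite inE gu.
  have [x ux] := I_neighbor uI; case gx : (g x) => [j|]; last first.
    by rewrite I_independent // inE gx in ux.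
  have := wp j u x gu gx ux; rewrite big1 => [/esym/eqP|i _]; first by rewrite oner_eq0.
  have /eqP := Qz (fun k _ => sqr_ge0 _) (Tagged (fun j => 'I_(n j)) i) isT.
  by rewrite sqrf_eq0 => /eqP /= ->; rewrite mul0r.
(* Selects the second vertex of a pair of twins, which takes the other root. *)
pose later u := [exists v, [&& v \in I, (enum_rank v < enum_rank u)%N &
   [forall y, adj u y == adj v y]]].
have later_neq u v : u \in I -> v \in I -> (enum_rank u < enum_rank v)%N ->
    (forall y, adj u y = adj v y) -> later u = later v -> False.
  move=> uI vI uv tw; have -> : later v = true.
    by apply/existsP; exists u; rewrite uI uv; apply/forallP => y; rewrite tw.
  move=> /existsP[t /and3P[tI tu /forallP twt]].
  apply: (I_twins uI vI tI _ tw) => [|y]; last exact/eqP.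
  rewrite /= !inE negb_or andbT; apply/andP; split; last first.
    by apply: contraTneq tu => <-; rewrite -leqNgt ltnW.
  by apply/andP; split; [apply: contraTneq uv => ->|apply: contraTneq tu => ->]; rewrite ltnn.
pose r u := Num.sqrt (1 + Q u).
pose s u := (1 + (-1) ^+ later u * r u) / Q u.
have sE u : g u = None -> s u ^+ 2 * Q u = 2 * s u + 1.
  move=> /Q0 Qu; have r2 : r u ^+ 2 = 1 + Q u by rewrite sqr_sqrtr // ltW // addr_gt0.
  have Qn0 := lt0r_neq0 Qu.
  have -> : s u ^+ 2 * Q u = (1 + 2 * ((-1) ^+ later u * r u) + r u ^+ 2) / Q u.
    by rewrite /s; case: (later u); field.
  by rewrite r2 /s; field.
pose psi x (k : {j : J & 'I_(n j)}) : R :=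
  match g x with
  | Some j => if j == tag k then p (tag k) x (tagged k) else 0
  | None => s x * w (tag k) x (tagged k)
  end.
pose ip x y := \sum_k psi x k * psi y k.
have ip_part x y j : g x = Some j -> ip x y =
    \sum_i p j x i * psi y (Tagged (fun j => 'I_(n j)) i).
  move=> gx; rewrite /ip (eq_bigr (fun k : {j : J & 'I_(n j)} =>
    psi x (Tagged (fun j => 'I_(n j)) (tagged k)) *
    psi y (Tagged (fun j => 'I_(n j)) (tagged k)))); last by case.
  rewrite -(sig_big_dep (fun=> true) (fun _ _ => true)
     (fun j i => psi x (Tagged (fun j => 'I_(n j)) i) * psi y (Tagged (fun j => 'I_(n j)) i))).
  rewrite /= (bigD1 j) //= [X in _ + X]big1 ?addr0 => [|i ij].
    by apply: eq_bigr => i _; rewrite /psi gx /= eqxx.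
  by apply: big1 => l _; rewrite {1}/psi gx /= eq_sym (negbTE ij) mul0r.
have ipC x y : ip x y = ip y x by apply: eq_bigr => k _; rewrite mulrC.
have ip_self x j : g x = Some j -> ip x x = 1.
  move=> gx; rewrite (ip_part _ _ j) // -(unit j x gx).
  by apply: eq_bigr => i _; rewrite /psi gx /= eqxx expr2.
have ip_same x y j : g x = Some j -> g y = Some j -> ip x y = \sum_i p j x i * p j y i.
  by move=> gx gy; rewrite (ip_part _ _ j) //; apply: eq_bigr => i _; rewrite /psi gy /= eqxx.
have ip_other x y i j : g x = Some i -> g y = Some j -> i != j -> ip x y = 0.
  move=> gx gy ij; rewrite (ip_part _ _ i) //; apply: big1 => k _.
  by rewrite /psi gy /= eq_sym (negbTE ij) mulr0.
have ip_none x u j : g x = Some j -> g u = None -> adj u x -> ip x u = s u.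
  move=> gx gu ux; rewrite (ip_part _ _ j) // -[RHS]mulr1 -(wp j u x gu gx ux) mulr_sumr.
  by apply: eq_bigr => i _; rewrite /psi gu /=; ring.
have ip_none_self u : g u = None -> ip u u = 2 * s u + 1.
  move=> gu; rewrite -sE // /ip /Q mulr_sumr.
  by apply: eq_bigr => k _; rewrite /psi gu; ring.
have dist x y : \sum_k (psi x k - psi y k) ^+ 2 = ip x x + ip y y - 2 * ip x y.
  by rewrite /ip mulr_sumr -big_split -sumrB; apply: eq_bigr => k _ /=; ring.
apply: (realizable_coordinates (psi := psi)) => [x y e|x y xy]; last first.
  rewrite dist; case gx : (g x) => [i|]; case gy : (g y) => [j|].
  - rewrite (ip_self x i) // (ip_self y j) //; case: (eqVneq i j) => [ij|ij].
      by rewrite (ip_same x y j) ?orth // ?gx ?ij //; ring.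
    by rewrite (ip_other x y i j) //; ring.
  - by rewrite (ip_self x i) // (ip_none_self y) // (ip_none x y i) // 1?adj_sym //; ring.
  - by rewrite (ip_self y j) // (ip_none_self x) // ipC (ip_none y x j) //; ring.
  - by rewrite I_independent ?inE ?gx ?gy // in xy.
have ips : ip x x = ip x y by apply: eq_bigr => k _; rewrite e.
have ips' : ip y y = ip x y by apply: eq_bigr => k _; rewrite e.
(* Points of [I] are off the unit sphere, so they never meet a point of a block. *)
have s_neq0 u : g u = None -> ip u u <> 1.
  move=> gu; rewrite ip_none_self // => s1.
  have s0 : s u = 0.
    by apply/eqP; move/eqP: s1; rewrite -subr_eq0 addrK mulf_eq0 pnatr_eq0.
  by have /esym/eqP := sE u gu; rewrite s0 expr0n /= mul0r mulr0 add0r oner_eq0.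
case gx : (g x) => [i|]; case gy : (g y) => [j|].
- case: (eqVneq i j) => [ij|ij]; last first.
    by have := ip_self x i gx; rewrite ips (ip_other x y i j) // => /esym/eqP; rewrite oner_eq0.
  rewrite ij in gx; apply: (inj j) => // l.
  by have := e (Tagged (fun j => 'I_(n j)) l); rewrite /psi gx gy /= eqxx.
- by case: (s_neq0 y gy); rewrite ips' -ips (ip_self x i).
- by case: (s_neq0 x gx); rewrite ips -ips' (ip_self y j).
(* Coinciding points of [I] have equal norms, hence equal [s], equal vectors [w] and equal
   neighbourhoods; the same root then means the same value of [later], impossible for distinct
   twins. *)
have ss : s x = s y.
  have : 2 * s x + 1 = 2 * s y + 1 by rewrite -!ip_none_self // ips ips'.
  by move=> /addIr; apply: mulfI; rewrite pnatr_eq0.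
have s0 : s x != 0.
  by apply/eqP => s0; apply: (s_neq0 x gx); rewrite ip_none_self // s0; ring.
have ww (k : {j : J & 'I_(n j)}) : w (tag k) x (tagged k) = w (tag k) y (tagged k).
  by apply: (mulfI s0); have := e k; rewrite /psi gx gy -ss.
have xI : x \in I by rewrite inE gx.
have yI : y \in I by rewrite inE gy.
have tw z : adj x z = adj y z.
  case gz : (g z) => [j|]; last by rewrite !I_independent // inE gz.
  by apply: (w_inj j) => // l; apply: (ww (Tagged (fun j => 'I_(n j)) l)).
have QQ : Q x = Q y by apply: eq_bigr => k _; rewrite ww.
have ll : later x = later y.
  have Qn0 : (Q x)^-1 != 0 by rewrite invr_eq0 gt_eqF ?Q0.
  have r0 : 0 < r x by rewrite sqrtr_gt0 addr_gt0 ?Q0.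
  move: ss; rewrite /s /r -QQ -/(r x) => /(mulIf Qn0) /addrI /(mulIf (lt0r_neq0 r0)).
  exact: signr_inj.
case: (ltngtP (enum_rank x) (enum_rank y)) => [xy|yx|/ord_inj/enum_rank_inj //].
  by case: (later_neq x y).
by case: (later_neq y x).
Qed.

End Assembly.

(** * Block dimensions and the conclusion *)

Definition block_size (d m : nat) (j : 'I_m) : nat := (2 + (odd d && (j == 0%N :> nat)))%N.

Lemma sum_block_size (d : nat) : (1 < d)%N -> (\sum_(j < d./2) block_size d j = d)%N.
Proof.
move=> d1; rewrite /block_size big_split /= sum_nat_const card_ord.
have [m dm] : exists m, d./2 = m.+1 by exists d./2.-1; rewrite prednK // half_gt0.
have -> : (\sum_(j < d./2) (odd d && (j == 0%N :> nat)) = odd d)%N.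
  by rewrite dm big_ord_recl big1 ?andbT ?addn0 // => i _; rewrite andbF.
by rewrite muln2 addnC odd_double_half.
Qed.

Lemma realizable_of_max_degree (R : realType) (d : nat) (G : sgraph) :
  (1 < d)%N -> max_degree G = d ->
  ~ (d = 3%N /\ contains_subgraph G (complete_bipartite 3 3)) ->
  realizable (R := R) (d := d) setT G.
Proof.
move=> d1 Gd noK; pose n := @block_size d d./2.
have [g gopt] := optimal_exists G n.
have n23 j : n j = 2%N \/ n j = 3%N.
  by rewrite /n /block_size; case: (_ && _); auto.
have n3 i j : n i = 3%N -> n j = 3%N -> i = j.
  rewrite /n /block_size; case: eqP => [i0|_]; case: eqP => [j0|_]; rewrite ?andbF //.
  by move=> _ _; apply: ord_inj; rewrite i0 j0.
have sumn := sum_block_size d1.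
have deg (x : G) : (degree x <= d)%N by rewrite -Gd; apply: degree_le_max.
have Idegree j u : g u = None -> #|[set x in [set x | g x == Some j] | adj u x]| = n j.
  move=> gu; rewrite -(optimal_none_degree n23 sumn deg gopt j gu) part_degreeE.
  by apply: eq_card => x; rewrite !inE andbC.
have part_lt x j (s : seq G) : g x = Some j -> uniq s ->
    (forall y, y \in s -> adj x y /\ g y = Some j) -> (size s < n j)%N.
  move=> gx us sP; apply: leq_ltn_trans (part_degree_ge_size us sP) _.
  exact: (optimal_some_degree n23 sumn deg gopt).
have dK : #|{: {j : 'I_d./2 & 'I_(n j)}}| = d.
  rewrite card_tagged sumnE big_map big_enum -[RHS]sumn /=.
  by apply: eq_bigr => j _; rewrite card_ord.
suff : realizable (R := R) (d := #|{: {j : 'I_d./2 & 'I_(n j)}}|) setT G by rewrite dK.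
apply: (realizable_assembly (g := g)).
- move=> j; case: (n23 j) => nj; rewrite nj.
    apply: plane_block => [a b c|u]; rewrite !inE; last by move=> /eqP /Idegree ->.
    move=> /eqP ga /eqP gb /eqP gc ab ac; apply: contrapT => /eqP bc.
    have := @part_lt a j [:: b; c] ga; rewrite /= inE bc nj => /(_ isT) H.
    by suff : false; last (apply: H => y; rewrite !inE => /orP[] /eqP ->).
  apply: space_block => [a b c e|u|u x y]; rewrite !inE.
  + move=> /eqP ga /eqP gb /eqP gc /eqP ge ab ac ae bc ce be.
    have := @part_lt a j [:: b; c; e] ga; rewrite /= !inE negb_or bc be ce nj => /(_ isT) H.
    by suff : false; last (apply: H => y; rewrite !inE => /or3P[] /eqP ->).
  + by move=> /eqP /Idegree ->.
  (* Internal degrees in the 3-space are below 3, so two neighbours are exactly two, as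
     [optimal_swap] requires. *)
  have deg2 v : g v = Some j -> two_neighbors [set x | g x == Some j] v ->
      part_degree g v (Some j) = 2%N.
    move=> gv [b [c []]]; rewrite !inE => /eqP gb /eqP gc bc vb vc; apply/eqP.
    rewrite eqn_leq -ltnS -[X in (_ < X)%N]nj (optimal_some_degree n23 sumn deg gopt) //=.
    apply: (@part_degree_ge_size _ _ g v (Some j) [:: b; c]); rewrite /= ?inE ?bc //.
    by move=> z; rewrite !inE => /orP[] /eqP ->.
  move=> /eqP gu /eqP gx /eqP gy ux uy xy /(deg2 x gx) dx /(deg2 y gy) dy.
  by apply: (optimal_swap n23 n3 sumn deg gopt nj gu gx gy) => //; rewrite eq_sym.
- move=> u v; rewrite !inE => /eqP gu /eqP gv.
  exact: part_degree_eq0 (optimal_none_edgeless n23 sumn deg gopt gu) gv.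
- move=> u; rewrite inE => /eqP gu.
  have j0 : 'I_d./2 by apply: Ordinal (_ : (0 < _)%N); rewrite half_gt0.
  have /card_gt0P[x] : (0 < #|[set x in [set x | g x == Some j0] | adj u x]|)%N.
    by rewrite Idegree //; case: (n23 j0) => ->.
  by rewrite !inE => /andP[_ ux]; exists x.
move=> u v w; rewrite !inE => /eqP gu /eqP gv /eqP gw uvw uv uw; apply: noK.
by apply: (optimal_twins n23 n3 sumn deg gopt (ltnW d1) uvw).
Qed.

Theorem theorem1 (R : realType) (d : nat) (G : sgraph) :
  (1 <= d)%N -> max_degree G = d ->
  (realizable (R := R) (d := d) setT G <->
   ~ (d = 3%N /\ contains_subgraph G (complete_bipartite 3 3))).
Proof.
move=> d_gt0 Gd; split=> [real [d3 K33]|noK33].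
  by move: real; rewrite d3; apply: complete_bipartite33_not_realizable.
(* For [d = 1] there is no block, as [d./2] is 0, so the line is treated directly. *)
case: (ltngtP d 1) => [|d1|d1]; first by rewrite ltnNge d_gt0.
  exact: realizable_of_max_degree.
by rewrite d1; apply: realizable_line; rewrite Gd.
Qed.
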